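(* Let $K/F$ be a cyclic Galois extension of number fields of degree $m$ with $\mathrm{Gal}(K/F)=\langle\sigma\rangle$, rings of integers $\mathcal{O}_F\subset\mathcal{O}_K$. Let $c\in\mathcal{O}_K\setminus\mathcal{O}_F$ be such that $A=(K/F,\sigma,c)=K[t;\sigma]/K[t;\sigma](t^m-c)$ is a nonassociative cyclic division algebra, with natural order $\Lambda=\mathcal{O}_K[t;\sigma]/\mathcal{O}_K[t;\sigma](t^m-c)$. Let $\mathfrak{q}$ be a prime ideal of $\mathcal{O}_F$ which is inert in $\mathcal{O}_K$, i.e. $\mathfrak{q}\mathcal{O}_K=\mathcal{Q}$ is a prime ideal of $\mathcal{O}_K$. Put $\overline{F}=\mathcal{O}_F/\mathfrak{q}$, $\overline{K}=\mathcal{O}_K/\mathcal{Q}$, $\overline{\sigma}(u+\mathcal{Q})=\sigma(u)+\mathcal{Q}$, $\bar c=c+\mathcal{Q}$. Then $$\Lambda/\mathfrak{q}\Lambda\cong(\overline{K}/\overline{F},\overline{\sigma},\bar c)$$ is a nonassociative cyclic algebra of degree $m$ over the finite field $\overline{F}$. If $m$ is prime or if $1,\bar c,\dots,\bar c^{m-1}$ are linearly independent over $\overline{F}$, then this is a central simple division algebra, and hence the only proper two-sided ideal $\mathcal{J}$ of $\Lambda$ containing $\mathfrak{q}\Lambda$ is $$\mathfrak{q}\Lambda=\bigoplus_{j=0}^{m-1}\mathfrak{q}\mathcal{O}_Kt^j.$$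
   Context: For a unital associative ring $S$ with injective endomorphism $\sigma$, $S[t;\sigma]$ is the skew polynomial ring with $ta=\sigma(a)t$. For monic $f$ of degree $m$, $S[t;\sigma]/S[t;\sigma]f$ (the Petit algebra) is the set of polynomials of degree $<m$ with multiplication $g\circ h=gh\bmod_r f$ (remainder of right division by $f$), a unital nonassociative ring. For commutative rings (here fields) $S_0\subset S$ with $S_0\subset\mathrm{Fix}(\sigma)$ and $c\in S$, $(S/S_0,\sigma,c)$ denotes $S[t;\sigma]/S[t;\sigma](t^m-c)$ regarded as an $S_0$-algebra. A nonassociative algebra $A$ over a field is a division algebra if left and right multiplication by every nonzero element are bijective.
   Formalization: In the case m prime it is additionally assumed that c̄ is not in F̄ (otherwise false: K=Q(i), F=Q, q=(3), c=3i gives c̄=0 and t∘t=0), and q is assumed nonzero so that F̄ is a finite field. *)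

(* Defs.v *)
From HB Require Import structures.
From mathcomp Require Import all_boot all_order all_algebra all_fingroup all_field.
Set Implicit Arguments. Unset Strict Implicit. Unset Printing Implicit Defensive.
Import GRing.Theory.
Local Open Scope ring_scope.

(* Skew polynomials in S[t; sigma] are represented by their coefficient lists
   {poly R} over an ambient ring R, with the skew product
   (sum a_i t^i)(sum b_j t^j) = sum a_i sigma^i(b_j) t^(i+j). *)
Definition skmul (R : nzRingType) (sigma : R -> R) (p q : {poly R}) : {poly R} :=
  \poly_(k < (size p + size q).-1)
     \sum_(i < k.+1) p`_i * iter i sigma q`_(k - i).

(* One reduction step modulo the monic f = t^m - c (remainder of RIGHT
   division, i.e. modulo the left ideal S[t;sigma] f):
   a t^(i+m) = (a t^i) f + a sigma^i(c) t^i. *)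
Definition red1 (R : nzRingType) (sigma : R -> R) (m : nat) (c : R)
  (p : {poly R}) : {poly R} :=
  \poly_(i < m) p`_i + \poly_(i < size p - m) (p`_(i + m) * iter i sigma c).

Definition rmodt (R : nzRingType) (sigma : R -> R) (m : nat) (c : R)
  (p : {poly R}) : {poly R} :=
  iter (size p) (red1 sigma m c) p.

Definition petit_mul (R : nzRingType) (sigma : R -> R) (m : nat) (c : R)
  (g h : {poly R}) : {poly R} :=
  rmodt sigma m c (skmul sigma g h).

Definition petit_carrier (R : nzRingType) (P : R -> Prop) (m : nat)
  (p : {poly R}) : Prop :=
  (size p <= m)%N /\ forall i, P p`_i.

Definition is_division_alg (R : nzRingType) (A : {poly R} -> Prop)
  (mul : {poly R} -> {poly R} -> {poly R}) : Prop :=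
  forall a, A a -> a <> 0 ->
    (forall x, A x -> A (mul a x) /\ A (mul x a)) /\
    (forall b, A b -> exists! x, A x /\ mul a x = b) /\
    (forall b, A b -> exists! x, A x /\ mul x a = b).

Definition two_sided_ideal (R : nzRingType) (A : {poly R} -> Prop)
  (mul : {poly R} -> {poly R} -> {poly R}) (J : {poly R} -> Prop) : Prop :=
  (forall x, J x -> A x) /\ J 0 /\
  (forall x y, J x -> J y -> J (x - y)) /\
  (forall a x, A a -> J x -> J (mul a x) /\ J (mul x a)).

Definition is_simple_alg (R : nzRingType) (A : {poly R} -> Prop)
  (mul : {poly R} -> {poly R} -> {poly R}) : Prop :=
  (exists x y, A x /\ A y /\ mul x y <> 0) /\
  forall J, two_sided_ideal A mul J ->
    (forall x, J x <-> x = 0) \/ (forall x, J x <-> A x).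

Definition in_nucleus (R : nzRingType) (A : {poly R} -> Prop)
  (mul : {poly R} -> {poly R} -> {poly R}) (x : {poly R}) : Prop :=
  A x /\ forall y z, A y -> A z ->
    mul (mul x y) z = mul x (mul y z) /\
    mul (mul y x) z = mul y (mul x z) /\
    mul (mul y z) x = mul y (mul z x).

Definition in_center (R : nzRingType) (A : {poly R} -> Prop)
  (mul : {poly R} -> {poly R} -> {poly R}) (x : {poly R}) : Prop :=
  in_nucleus A mul x /\ forall y, A y -> mul x y = mul y x.

Definition is_central_over (R : nzRingType) (Fb : R -> Prop)
  (A : {poly R} -> Prop) (mul : {poly R} -> {poly R} -> {poly R}) : Prop :=
  forall x, in_center A mul x <-> exists a, Fb a /\ x = a%:P.

Definition ring_of_integers (F0 : fieldType) (L : fieldExtType F0)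
  (K : {vspace L}) (x : L) : Prop :=
  x \in K /\ integralOver intr x.

Definition is_ideal (L : fieldType) (O I : L -> Prop) : Prop :=
  (forall x, I x -> O x) /\ I 0 /\
  (forall x y, I x -> I y -> I (x - y)) /\
  (forall a x, O a -> I x -> I (a * x)).

Definition is_prime_ideal (L : fieldType) (O I : L -> Prop) : Prop :=
  is_ideal O I /\ (exists x, O x /\ ~ I x) /\
  (forall a b, O a -> O b -> I (a * b) -> I a \/ I b).

Definition ext_ideal (L : fieldType) (q O : L -> Prop) (x : L) : Prop :=
  exists s : seq (L * L), (forall u, u \in s -> q u.1 /\ O u.2) /\
    x = \sum_(u <- s) u.1 * u.2.

Definition ideal_times (L : fieldType) (q : L -> Prop) (Lam : {poly L} -> Prop)
  (p : {poly L}) : Prop :=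
  exists s : seq (L * {poly L}), (forall u, u \in s -> q u.1 /\ Lam u.2) /\
    p = \sum_(u <- s) u.1 *: u.2.

(* Main.v *)
(* Right multiplication by x in the Petit algebra of t^m - c is left linear, with
   rows T^i x for T p = t p mod (t^m - c).  A nonzero a with a x = 0 makes the
   span M of the T^i x with i < deg a stable under T.  But T^m acts on K t^k as
   multiplication by sigma^k(c); when these scalars are distinct, M contains some
   t^k, hence all of them, which is impossible for dimension reasons.  So there
   are no zero divisors, and over a finite field this gives a division algebra.
   The scalars are distinct when 1, c, ..., c^(m-1) are independent over the fixed
   field, because the product of the X - sigma^i(c) over a shorter period would be
   a relation; for m prime every nonfixed c qualifies.

   The residue extension has the right Galois theory for two reasons.  If sigma-bar
   fixes the class z of x, the polynomial of the conjugates of x reduces to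
   (X - z)^m, which forces z into F-bar.  If sigma-bar^k is trivial, a
   primitive element of K-bar has degree at most k over F-bar, and Nakayama's
   lemma lifts this to [K : F] <= k; it applies because O_K is finitely generated
   over Z, the trace form embedding it in some Z^N. *)
Require Import Defs.
From HB Require Import structures.
From mathcomp Require Import all_boot all_order all_algebra all_fingroup all_field.
From mathcomp Require Import cyclic zify ring.
From Stdlib Require Import Classical.
Set Implicit Arguments. Unset Strict Implicit. Unset Printing Implicit Defensive.
Import GRing.Theory Order.TTheory Num.Theory.
Local Open Scope ring_scope.

(** * Multiplication in Petit algebras *)

Section PetitMul.
Variables (R : nzRingType) (f : R -> R) (m : nat) (c : R).
Hypothesis f0 : f 0 = 0.

Lemma iter_fix0 i : iter i f 0 = 0.
Proof. by elim: i => //= i ->. Qed.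

Lemma red1_id (p : {poly R}) : (size p <= m)%N -> red1 f m c p = p.
Proof.
move=> sp; apply/polyP=> i; rewrite /red1 coefD !coef_poly.
have /eqP -> : (size p - m == 0)%N by rewrite subn_eq0.
by rewrite ltn0 addr0; case: ltnP => // /(leq_trans sp) /leq_sizeP ->.
Qed.

(** A degree below 2m drops below m after one reduction, and every later step of the iteration is
    the identity. For the zero polynomial the iteration runs no step at all, so that case is
    separate. *)
Lemma rmodt_red1 (p : {poly R}) : (size p <= m + m)%N -> rmodt f m c p = red1 f m c p.
Proof.
move=> sp; rewrite /rmodt; case: (posnP (size p)) => [p0|].
  by rewrite p0 /= red1_id // p0.
have s1 : (size (red1 f m c p) <= m)%N.
  rewrite (leq_trans (size_polyD _ _)) // geq_max !(leq_trans (size_poly _ _)) //.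
  by rewrite leq_subLR.
case: (size p) => // n _; elim: n => //= n IHn.
by rewrite IHn red1_id.
Qed.

Lemma coef_skmul (p q : {poly R}) k :
  (skmul f p q)`_k = \sum_(i < k.+1) p`_i * iter i f q`_(k - i).
Proof.
rewrite coef_poly; case: ltnP => // le_pq_k.
rewrite big1 // => i _.
case: (ltnP i (size p)) => [ip|/leq_sizeP -> //]; last by rewrite mul0r.
rewrite [q`_ _]nth_default ?iter_fix0 ?mulr0 //.
have := ltn_ord i; move: le_pq_k ip; move: (nat_of_ord i) (size p) (size q) => a b d; lia.
Qed.

Lemma coef_red1 (p : {poly R}) k : (red1 f m c p)`_k =
  if (k < m)%N then p`_k + p`_(k + m) * iter k f c else p`_(k + m) * iter k f c.
Proof.
rewrite /red1 coefD !coef_poly; have -> :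
    (if (k < size p - m)%N then p`_(k + m) * iter k f c else 0) = p`_(k + m) * iter k f c.
  by case: ltnP => // ?; rewrite nth_default ?mul0r // addnC -leq_subLR.
by case: ifP; rewrite ?add0r.
Qed.

(** Degrees stay below 2m, so t^k receives only the terms of t^k and of t^(k+m). The index [i] alone
    decides which: [i <= k] gives an unreduced term, [i > k] one that wraps around and picks up the
    conjugate f^k(c). *)
Lemma coef_petit_mul (g h : {poly R}) k :
  (size g <= m)%N -> (size h <= m)%N ->
  (petit_mul f m c g h)`_k =
    if (k < m)%N then
      \sum_(i < m) g`_i * (if (i <= k)%N then iter i f h`_(k - i)
                           else iter i f h`_(m + k - i) * iter k f c)
    else 0.
Proof.
move=> sg sh.
have ssk : (size (skmul f g h) <= m + m)%N.
  by rewrite (leq_trans (size_poly _ _)) // (leq_trans (leq_pred _)) // leq_add.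
rewrite /petit_mul rmodt_red1 // coef_red1; case: ltnP => [km|mk]; last first.
  by rewrite nth_default ?mul0r // (leq_trans ssk) // leq_add2r.
rewrite !coef_skmul (bigID (fun i : 'I_m => (i <= k)%N)) /=; congr (_ + _).
  rewrite (big_ord_widen_cond _ xpredT (fun i => g`_i * iter i f h`_(k - i)) km) /=.
  by apply: eq_big => [i|i ik]; rewrite ?ltnS // -ltnS ik.
have mkm : (m <= (k + m).+1)%N by lia.
rewrite big_distrl /= (big_ord_widen_cond _ (fun i => ~~ (i <= k)%N)
  (fun i => g`_i * (if (i <= k)%N then iter i f h`_(k - i)
     else iter i f h`_(m + k - i) * iter k f c)) mkm) /=.
rewrite [RHS]big_mkcond; apply: eq_bigr => i _ /=.
case: (leqP i k) => ik /=.
  by rewrite [h`_ _]nth_default ?iter_fix0 ?mulr0 ?mul0r // (leq_trans sh) //; lia.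
case: ifP => im; first by rewrite mulrA (addnC m).
by rewrite [g`_i]nth_default ?mul0r // (leq_trans sg) // leqNgt im.
Qed.

Lemma size_petit_mul (g h : {poly R}) :
  (size g <= m)%N -> (size h <= m)%N -> (size (petit_mul f m c g h) <= m)%N.
Proof.
move=> sg sh; apply/leq_sizeP => j mj.
by rewrite coef_petit_mul // ltnNge mj.
Qed.

End PetitMul.

(** * Left multiplication by t as a semilinear operator *)

Section Residue.
Variables (R : comNzRingType) (f : {rmorphism R -> R}) (m : nat) (c : R).

Lemma iter_rmorph_zmod i : zmod_morphism (iter i f).
Proof. by elim: i => //= i IHi x y /=; rewrite IHi rmorphB. Qed.

Lemma iter_rmorph_monoid i : monoid_morphism (iter i f).
Proof.
by elim: i => //= i [IH1 IHM]; split=> [|x y] /=; rewrite ?IH1 ?rmorph1 ?IHM ?rmorphM.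
Qed.

HB.instance Definition _ i := GRing.isZmodMorphism.Build R R (iter i f) (iter_rmorph_zmod i).
HB.instance Definition _ i := GRing.isMonoidMorphism.Build R R (iter i f) (iter_rmorph_monoid i).

(** This is p -> t p mod (t^m - c): coefficients are twisted by [f] and shifted up, and the top one
    returns to degree 0 with a factor c. *)
Definition tmul (p : {poly R}) : {poly R} :=
  \poly_(k < m) if k is k'.+1 then f p`_k' else f p`_m.-1 * c.

Lemma tmul_is_zmod_morphism : zmod_morphism tmul.
Proof.
move=> p q; apply/polyP=> i; rewrite coefB !coef_poly.
by case: ifP; rewrite ?subr0 //; case: i => [|i]; rewrite coefB rmorphB ?mulrBl.
Qed.
HB.instance Definition _ :=
  GRing.isZmodMorphism.Build {poly R} {poly R} tmul tmul_is_zmod_morphism.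

Lemma tmulZ a p : tmul (a *: p) = f a *: tmul p.
Proof.
apply/polyP=> i; rewrite coefZ !coef_poly.
by case: ifP; rewrite ?mulr0 //; case: i => [|i]; rewrite coefZ rmorphM ?mulrA.
Qed.

Lemma iter_tmulB i p q : iter i tmul (p - q) = iter i tmul p - iter i tmul q.
Proof. by elim: i => //= i ->; rewrite raddfB. Qed.

(** The right-hand side is the expression occurring in [coef_petit_mul]. The range includes [i = m],
    where every coefficient has wrapped around once; this is what makes T^m diagonal. *)
Lemma coef_iter_tmul (h : {poly R}) i k : (size h <= m)%N -> (i <= m)%N -> (k < m)%N ->
  (iter i tmul h)`_k = if (i <= k)%N then iter i f h`_(k - i)
                       else iter i f h`_(m + k - i) * iter k f c.
Proof.
move=> sh; elim: i k => [|i IHi] k im km; first by rewrite leq0n subn0.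
rewrite iterS coef_poly km; case: k km => [|k] km.
  rewrite IHi ?(ltnW im) //; last by lia.
  have -> : (i <= m.-1)%N by lia.
  by congr (f (iter _ _ _) * _); congr (_`_ _); lia.
rewrite IHi ?(ltnW im) ?(ltnW km) // ltnS; case: ifP => // ik.
by rewrite rmorphM addnS subSS.
Qed.

Lemma petit_mulE (g h : {poly R}) : (size g <= m)%N -> (size h <= m)%N ->
  petit_mul f m c g h = \sum_(i < m) g`_i *: iter i tmul h.
Proof.
move=> sg sh; apply/polyP=> k; rewrite coef_petit_mul ?rmorph0 // coef_sum.
case: ltnP => km.
  by apply: eq_bigr => i _; rewrite coefZ coef_iter_tmul // ltnW.
rewrite big1 // => i _; rewrite coefZ [X in _ * X]nth_default ?mulr0 //.
apply: leq_trans km; case: i => -[|i] im //=.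
exact: size_poly.
Qed.

End Residue.

(** * Absence of zero divisors when the conjugates of c are distinct *)

Section NoZeroDivisors.
Variables (K : fieldType) (f : {rmorphism K -> K}) (m : nat) (c : K).
Hypothesis fm : forall z, iter m f z = z.
Hypothesis m_gt0 : (0 < m)%N.
Hypothesis c_neq0 : c != 0.
Hypothesis conj_inj : forall i j, (i < m)%N -> (j < m)%N -> iter i f c = iter j f c -> i = j.

Let T := tmul f m c.

Lemma tmulXn k : (k.+1 < m)%N -> T 'X^k = 'X^(k.+1).
Proof.
move=> km; apply/polyP=> i; rewrite coef_poly !coefXn.
case: i => [|i]; last by rewrite coefXn rmorph_nat; case: ltnP => //; case: eqP => //; lia.
by have -> : (m.-1 == k) = false; [apply/eqP; lia | rewrite rmorph0 mul0r if_same].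
Qed.

Lemma tmulXn_pred : T 'X^(m.-1) = c%:P.
Proof.
apply/polyP=> i; rewrite coef_poly coefC.
case: i => [|i]; last first.
  case: ltnP => //= im; rewrite coefXn (_ : (i == m.-1) = false) ?rmorph0 //.
  by apply/eqP; lia.
rewrite coefXn eqxx rmorph1 mul1r; by rewrite m_gt0.
Qed.

Section Invariant.
(* A [K]-subspace of polynomials of degree < m that is stable under [T], i.e.
   a left submodule of K[t; f] / K[t; f](t^m - c). *)
Variable M : {poly K} -> Prop.
Hypothesis M0 : M 0.
Hypothesis MD : forall p q, M p -> M q -> M (p + q).
Hypothesis MZ : forall a p, M p -> M (a *: p).
Hypothesis MT : forall p, M p -> M (T p).

Lemma iter_tmul_diag (p : {poly K}) : (size p <= m)%N ->
  iter m T p = \poly_(k < m) (p`_k * iter k f c).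
Proof.
move=> sp; apply/polyP=> k; rewrite coef_poly; case: ltnP => [km|mk].
  by rewrite coef_iter_tmul // leqNgt km /= fm addKn.
by rewrite -[X in iter X](prednK m_gt0) iterS coef_poly ltnNge mk.
Qed.

(* T^m acts on K t^k as multiplication by f^k(c), so polynomials in T^m act as
   diagonal operators. *)
Lemma invariant_horner (h p : {poly K}) : M p -> (size p <= m)%N ->
  M (\poly_(k < m) (p`_k * h.[iter k f c])).
Proof.
move=> Mp sp; elim/poly_ind: h => [|h a IHh].
  rewrite [X in M X](_ : _ = 0) //; apply/polyP=> k.
  by rewrite coef_poly horner0 mulr0 if_same coef0.
rewrite [X in M X](_ : _ = iter m T (\poly_(k < m) (p`_k * h.[iter k f c])) + a *: p).
  by apply: MD; [elim: {1}m => //= n; apply: MT | apply: MZ].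
rewrite iter_tmul_diag ?size_poly //; apply/polyP=> k.
rewrite coefD coefZ !coef_poly; case: ltnP => km; first by rewrite hornerMXaddC; ring.
by rewrite [p`_k]nth_default ?(leq_trans sp) // mulr0 addr0.
Qed.

Lemma invariant_full (p : {poly K}) : M p -> (size p <= m)%N -> p != 0 -> forall k, (k < m)%N -> M 'X^k.
Proof.
move=> Mp sp p0.
have [k0 k0m pk0] : exists2 k0, (k0 < m)%N & p`_k0 != 0.
  exists (size p).-1; last by rewrite -lead_coefE lead_coef_eq0.
  by rewrite (leq_trans _ sp) // prednK ?size_poly_gt0.
have Mk0 : M 'X^k0.
  (* Lagrange interpolation: [h] vanishes at every conjugate of c except the one of index [k0], so
     h(T^m) projects [p] onto its t^k0 term. *)
  pose h := \prod_(j < m | j != k0 :> nat) ('X - (iter j f c)%:P).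
  have hk0 : h.[iter k0 f c] != 0.
    rewrite horner_prod prodf_seq_neq0; apply/allP => j _; apply/implyP=> jk0.
    rewrite hornerXsubC subr_eq0; apply: contra_neq jk0 => e.
    exact/esym/conj_inj.
  have := MZ (p`_k0 * h.[iter k0 f c])^-1 (invariant_horner h Mp sp).
  rewrite [X in M X](_ : _ = 'X^k0) //; apply/polyP=> k.
  rewrite coefZ coef_poly coefXn; case: (eqVneq k k0) => [->|kk0].
    by rewrite k0m mulVf // mulf_neq0.
  case: ltnP => km; last by rewrite mulr0.
  have -> : h.[iter k f c] = 0; last by rewrite !mulr0.
  by rewrite horner_prod (bigD1 (Ordinal km)) //= hornerXsubC /= subrr mul0r.
(* Applying T climbs from t^k0 to t^(m-1), then to the constant c; dividing by c gives 1, from which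
   T reaches every power. *)
have up k : M 'X^k -> forall j, (k <= j < m)%N -> M 'X^j.
  move=> Mk; elim=> [|j IHj] /andP[kj jm]; first by move: kj; rewrite leqn0 => /eqP <-.
  move: kj; rewrite leq_eqVlt => /orP[/eqP <- //|kj].
  by rewrite -tmulXn //; apply/MT/IHj; rewrite -ltnS kj ltnW.
have Mc : M c%:P by rewrite -tmulXn_pred; apply/MT/(up k0) => //; apply/andP; lia.
have M1 : M 'X^0 by have := MZ c^-1 Mc; rewrite -mul_polyC -polyCM mulVf.
by move=> k km; apply: (up 0).
Qed.

End Invariant.

Lemma petit_mul_eq0 (a x : {poly K}) : (size a <= m)%N -> (size x <= m)%N ->
  petit_mul f m c a x = 0 -> a = 0 \/ x = 0.
Proof.
move=> sa sx; rewrite petit_mulE // => ax0.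
case: (eqVneq a 0) => [|a0]; [by left | right]; apply/eqP; apply: contraT => x0.
pose d := (size a).-1.
have dm : (d < m)%N by rewrite (leq_trans _ sa) // prednK ?size_poly_gt0.
have ad : a`_d != 0 by rewrite -lead_coefE lead_coef_eq0.
(* With d = deg a, this is the span of x, Tx, ..., T^(d-1) x. Its stability under T needs only T^d x
   in the span, and a x = 0 gives that after division by the leading coefficient of [a]. *)
pose M p := exists b : 'I_d -> K, p = \sum_(i < d) b i *: iter i T x.
have M0 : M 0 by exists (fun=> 0); rewrite big1 // => i _; rewrite scale0r.
have MD p q : M p -> M q -> M (p + q).
  move=> [b ->] [b' ->]; exists (fun i => b i + b' i); rewrite -big_split /=.
  by apply: eq_bigr => i _; rewrite scalerDl.
have MZ e p : M p -> M (e *: p).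
  move=> [b ->]; exists (fun i => e * b i); rewrite scaler_sumr.
  by apply: eq_bigr => i _; rewrite scalerA.
have Msum (I : finType) (P : pred I) (F : I -> {poly K}) :
    (forall i, P i -> M (F i)) -> M (\sum_(i | P i) F i).
  by move=> MF; apply: big_ind.
have Mlow i : (i < d)%N -> M (iter i T x).
  move=> id; exists (fun j => (j == i :> nat)%:R).
  rewrite (bigD1 (Ordinal id)) //= eqxx scale1r big1 ?addr0 // => j ji.
  by rewrite (_ : _ == _ = false) ?scale0r //; apply/negbTE.
have Mtop : M (iter d T x).
  have -> : iter d T x = \sum_(i < d) (- (a`_d)^-1 * a`_i) *: iter i T x.
    have := ax0; rewrite (bigID (fun i : 'I_m => (i < d)%N)) /=.
    rewrite -(big_ord_widen _ (fun i => a`_i *: iter i T x) (ltnW dm)) /=.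
    rewrite (bigD1 (Ordinal dm))  ?ltnn //= [X in _ + (_ + X)]big1 ?addr0 => [|i /andP[di idd]]; last first.
      rewrite nth_default ?scale0r //; move: di idd; rewrite -leqNgt -val_eqE /= /d.
      by move: a0; rewrite -size_poly_gt0; move: (size a) => s; lia.
    move/eqP; rewrite addrC addr_eq0 => /eqP e.
    rewrite -[LHS]scale1r -(mulVf ad) -scalerA e scalerN scaler_sumr -sumrN.
    by apply: eq_bigr => i _; rewrite scalerA -scaleNr mulNr.
  by apply: Msum => i _; apply/MZ/Mlow.
have MT p : M p -> M (T p).
  move=> [b ->]; rewrite /T raddf_sum; apply: Msum => i _.
  rewrite /= tmulZ; apply: MZ; rewrite -iterS -/T.
  by have := ltn_ord i; rewrite leq_eqVlt => /orP[/eqP -> //|]; apply: Mlow.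
(* For d = 0 the span is zero and has no generator [x]; there [Mtop] itself says that x = T^0 x lies
   in it. *)
have Mx : M x.
  case: (posnP d) => [d0|]; last exact: (Mlow 0).
  by move: Mtop; rewrite {1}d0.
have [b bE] : exists b : 'I_m -> 'I_d -> K,
    forall k : 'I_m, 'X^k = \sum_(i < d) b k i *: iter i T x.
  apply: (@fin_all_exists _ _ (fun (k : 'I_m) (y : 'I_d -> K) => 'X^k = \sum_(i < d) y i *: iter i T x)) => k.
  exact: (invariant_full M0 MD MZ MT Mx sx x0).
(* The m monomials are combinations of d < m vectors, so the identity matrix of size m would factor
   through dimension d. *)
have : (\matrix_(k < m, i < d) b k i) *m (\matrix_(i < d, k < m) (iter i T x)`_k) = 1%:M.
  apply/matrixP=> k l; rewrite !mxE -val_eqE /= eq_sym -coefXn bE coef_sum.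
  by apply: eq_bigr => i _; rewrite !mxE coefZ.
by move/mulmx1_min; rewrite leqNgt dm.
Qed.

End NoZeroDivisors.

(** Pigeonhole on a duplicate-free list. It turns the injectivity of multiplications into
    bijectivity. *)
Lemma finite_inj_surj (T : eqType) (s : seq T) (g : T -> T) :
  {in s, forall x, g x \in s} -> {in s &, injective g} ->
  forall b, b \in s -> exists2 x, x \in s & g x = b.
Proof.
move=> gs ginj b bs; pose u := undup s.
have sub : {subset map g u <= u}.
  by move=> y /mapP[x xs ->]; rewrite mem_undup gs // -mem_undup.
have uu : uniq (map g u).
  by rewrite map_inj_in_uniq ?undup_uniq // => x y; rewrite !mem_undup; apply: ginj.
have [_ e] := uniq_min_size uu sub (eq_leq (esym (size_map _ _))).
have : b \in map g u by rewrite e mem_undup.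
by case/mapP => x; rewrite mem_undup; exists x.
Qed.

Lemma finite_polys (K : nzRingType) (s : seq K) (m : nat) : (forall z, z \in s) ->
  exists S : seq {poly K}, forall p : {poly K}, (p \in S) = (size p <= m)%N.
Proof.
move=> sP; exists (map (fun u : {ffun 'I_m -> seq_sub s} => \poly_(i < m)
  (if insub i is Some j then ssval (u j) else 0)) (enum {ffun 'I_m -> seq_sub s})).
move=> p; apply/mapP/idP => [[u _ ->]|sp]; first exact: size_poly.
exists [ffun i : 'I_m => SeqSub (sP p`_i)]; first by rewrite mem_enum.
apply/polyP=> i; rewrite coef_poly; case: ltnP => im; last by rewrite nth_default // (leq_trans sp).
by rewrite insubT /= ffunE.
Qed.

(** * Division, simplicity and centre over a finite field *)

Section FiniteDivision.
Variables (K : fieldType) (s : seq K) (f : {rmorphism K -> K}) (m : nat) (c : K).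
Hypothesis sP : forall z, z \in s.
Hypothesis fm : forall z, iter m f z = z.
Hypothesis m_gt1 : (1 < m)%N.
Hypothesis conj_inj : forall i j, (i < m)%N -> (j < m)%N -> iter i f c = iter j f c -> i = j.

Let A := petit_carrier (fun _ : K => True) m.
Let mul := petit_mul f m c.

Let m_gt0 : (0 < m)%N. Proof. exact: ltnW. Qed.

(** Since m > 1, c = 0 would give the indices 0 and 1 the same conjugate. *)
Let c_neq0 : c != 0.
Proof.
apply/eqP=> c0; have := conj_inj m_gt0 m_gt1.
by rewrite /= c0 rmorph0 => /(_ erefl).
Qed.

Let AP p : A p <-> (size p <= m)%N. Proof. by split=> [[]|]. Qed.

Let mulB a x y : A a -> A x -> A y -> mul a (x - y) = mul a x - mul a y.
Proof.
move=> /AP sa /AP sx /AP sy; have sxy : (size (x - y)%R <= m)%N.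
  by rewrite (leq_trans (size_polyD _ _)) // size_polyN geq_max sx.
rewrite /mul !petit_mulE // -sumrB; apply: eq_bigr => i _.
by rewrite iter_tmulB scalerBr.
Qed.

Let mulBl a x y : A a -> A x -> A y -> mul (x - y) a = mul x a - mul y a.
Proof.
move=> /AP sa /AP sx /AP sy; have sxy : (size (x - y)%R <= m)%N.
  by rewrite (leq_trans (size_polyD _ _)) // size_polyN geq_max sx.
rewrite /mul !petit_mulE // -sumrB; apply: eq_bigr => i _.
by rewrite coefB scalerBl.
Qed.

Let A_mul x y : A x -> A y -> A (mul x y).
Proof. by move=> /AP sx /AP sy; apply/AP/size_petit_mul; rewrite ?rmorph0. Qed.

Let AB x y : A x -> A y -> A (x - y).
Proof.
by move=> /AP sx /AP sy; apply/AP; rewrite (leq_trans (size_polyD _ _)) // size_polyN geq_max sx.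
Qed.

Lemma petit_division : is_division_alg A mul.
Proof.
have mul_eq0 := petit_mul_eq0 fm m_gt0 c_neq0 conj_inj.
have [S SP] := finite_polys m sP.
move=> a Aa a0; split; first by move=> x Ax; split; apply: A_mul.
have injl x y : A x -> A y -> mul a x = mul a y -> x = y.
  move=> Ax Ay e; apply/eqP; rewrite -subr_eq0; apply/eqP.
  have := mul_eq0 a (x - y); rewrite -/mul mulB // e subrr.
  by case=> //; apply/AP => //; apply: AB.
have injr x y : A x -> A y -> mul x a = mul y a -> x = y.
  move=> Ax Ay e; apply/eqP; rewrite -subr_eq0; apply/eqP.
  have := mul_eq0 (x - y) a; rewrite -/mul mulBl // e subrr.
  by case=> //; apply/AP => //; apply: AB.
split=> b /AP Ab.
  have [|||x] := @finite_inj_surj _ S (mul a) _ _ b.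
  - by move=> x; rewrite !SP => /AP Ax; apply/AP/A_mul.
  - by move=> x y; rewrite !SP => /AP Ax /AP Ay; apply: injl.
  - by rewrite SP.
  rewrite SP => /AP Ax e; exists x; split=> // y [Ay ey].
  by apply: injl => //; rewrite e.
have [|||x] := @finite_inj_surj _ S (mul^~ a) _ _ b.
- by move=> x; rewrite !SP => /AP Ax; apply/AP/A_mul.
- by move=> x y; rewrite !SP => /AP Ax /AP Ay; apply: injr.
- by rewrite SP.
rewrite SP => /AP Ax e; exists x; split=> // y [Ay ey].
by apply: injr => //; rewrite e.
Qed.

Lemma petit_simple : is_simple_alg A mul.
Proof.
have A1 : A 1 by apply/AP; rewrite size_poly1.
split.
  exists 1, 1; split=> //; split=> //.
  move=> e11; have := petit_mul_eq0 fm m_gt0 c_neq0 conj_inj _ _ e11.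
  by rewrite size_poly1 => /(_ m_gt0 m_gt0) [] /eqP; rewrite oner_eq0.
move=> J [JA [J0 [_ Jmul]]].
case: (classic (exists2 a, J a & a <> 0)) => [[a Ja a0]|nJ]; [right | left] => x.
  split=> [/JA //|Ax].
  (* A nonzero [a] in [J] already generates everything: any [x] is of the form [y] times [a]. *)
  have [_ [_ surj]] := petit_division (JA _ Ja) a0.
  have [y [[Ay <-] _]] := surj x Ax.
  by have [] := Jmul y a Ay Ja.
split=> [Jx|-> //]; apply: NNPP => x0; apply: nJ; by exists x.
Qed.

Let mulC a x : A x -> mul a%:P x = a *: x.
Proof.
move=> /AP sx; rewrite /mul petit_mulE //; last by rewrite (leq_trans (size_polyC_leq1 _)).
rewrite (bigD1 (Ordinal m_gt0)) //= coefC eqxx big1 ?addr0 // => i.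
by rewrite -val_eqE /= coefC => /negbTE ->; rewrite scale0r.
Qed.

Let coef_mulC a x i : A x -> (mul x a%:P)`_i = x`_i * iter i f a.
Proof.
move=> /AP sx; have sa : (size a%:P <= m)%N by rewrite (leq_trans (size_polyC_leq1 _)).
rewrite coef_petit_mul ?rmorph0 //; case: ltnP => im; last first.
  by rewrite [x`_i]nth_default ?mul0r // (leq_trans sx).
rewrite (bigD1 (Ordinal im)) //= leqnn subnn coefC eqxx big1 ?addr0 // => j.
rewrite -val_eqE /= => ji; have jm := ltn_ord j.
have iter0 k : iter k f 0 = 0 by rewrite iter_fix0 ?rmorph0.
case: (leqP j i) => ij; rewrite coefC.
  by rewrite (_ : (i - j == 0)%N = false) ?iter0 ?mulr0 //; apply/eqP; lia.
by rewrite (_ : (m + i - j == 0)%N = false) ?iter0 ?mul0r ?mulr0 //; apply/eqP; lia.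
Qed.

(** Commuting with c kills the coefficient of t^i for 0 < i < m, because f^i(c) differs from c.
    Commuting with t then forces the constant term to be fixed by [f]. Conversely a fixed constant
    acts as a scalar for which the product is bilinear, so it lies in the nucleus and commutes. *)
Lemma petit_central (Fb : K -> Prop) : (forall z, f z = z <-> Fb z) ->
  is_central_over Fb A mul.
Proof.
move=> FbP x; split.
  move=> [[Ax _] comm].
  have AC b : A b%:P by apply/AP; rewrite (leq_trans (size_polyC_leq1 _)).
  have xi i : (0 < i < m)%N -> x`_i = 0.
    move=> /andP[i0 im]; have := congr1 (fun p : {poly K} => p`_i) (comm _ (AC c)).
    rewrite mulC // coef_mulC // coefZ mulrC => /eqP.
    rewrite -subr_eq0 -mulrBl mulf_eq0 => /orP[|/eqP //].
    rewrite subr_eq0 => /eqP e; have := conj_inj im m_gt0 e.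
    by move: i0; lia.
  have xE : x = (x`_0)%:P.
    apply/polyP=> -[|i]; rewrite coefC //=.
    case: (ltnP i.+1 m) => im; first exact: xi.
    by rewrite nth_default // (leq_trans _ im) //; apply/AP.
  exists x`_0; split=> //; apply/FbP.
  have AX : A 'X by apply/AP; rewrite size_polyX.
  have := congr1 (fun p : {poly K} => p`_1) (comm _ AX).
  by rewrite xE mulC // coef_mulC // coefZ coefX coefC /= mulr1 mul1r.
move=> [a [/FbP fa ->]].
have Aa : A a%:P by apply/AP; rewrite (leq_trans (size_polyC_leq1 _)).
have itera i : iter i f a = a by elim: i => //= i ->.
have mulCr x' : A x' -> mul x' a%:P = a *: x'.
  by move=> Ax; apply/polyP=> i; rewrite coef_mulC // itera coefZ mulrC.
have AZ x' : A x' -> A (a *: x').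
  by move=> /AP sx; apply/AP; rewrite (leq_trans (size_scale_leq _ _)).
have mulZl y z : A y -> A z -> mul (a *: y) z = a *: mul y z.
  move=> Ay Az; rewrite /mul !petit_mulE; try by [apply/AP | apply/AP/AZ].
  by rewrite scaler_sumr; apply: eq_bigr => i _; rewrite coefZ scalerA.
have mulZr y z : A y -> A z -> mul y (a *: z) = a *: mul y z.
  move=> Ay Az; rewrite /mul !petit_mulE; try by [apply/AP | apply/AP/AZ].
  rewrite scaler_sumr; apply: eq_bigr => i _.
  have -> : iter i (tmul f m c) (a *: z) = a *: iter i (tmul f m c) z.
    by elim: (i : nat) => //= j ->; rewrite tmulZ fa.
  by rewrite !scalerA mulrC.
split; last by move=> y Ay; rewrite mulC // mulCr.
split=> // y z Ay Az; have Ayz := A_mul Ay Az.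
by rewrite !mulC // !mulCr // ?mulZl ?mulZr //.
Qed.

End FiniteDivision.

(** * Finite fields and conjugates *)

Definition orbit_poly (R : comNzRingType) (f : R -> R) (k : nat) (x : R) : {poly R} :=
  \prod_(i < k) ('X - (iter i f x)%:P).

(** [f] permutes the linear factors cyclically, since the last one returns to the first. *)
Lemma orbit_poly_fixed (R : comNzRingType) (f : {rmorphism R -> R}) k x :
  iter k f x = x -> map_poly f (orbit_poly f k x) = orbit_poly f k x.
Proof.
move=> fk; rewrite /orbit_poly rmorph_prod.
under eq_bigr => i _ do rewrite /= map_polyXsubC -iterS.
case: k fk => [|k] fk; first by rewrite !big_ord0.
by rewrite big_ord_recr [RHS]big_ord_recl fk mulrC.
Qed.

Lemma monic_orbit_poly (R : comNzRingType) (f : R -> R) k x : orbit_poly f k x \is monic.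
Proof. exact: monic_prod_XsubC. Qed.

Lemma size_orbit_poly (R : comNzRingType) (f : R -> R) k x : size (orbit_poly f k x) = k.+1.
Proof. by rewrite size_prod_XsubC /index_enum -enumT size_enum_ord. Qed.

Lemma root_orbit_poly (R : idomainType) (f : R -> R) k x :
  (0 < k)%N -> (orbit_poly f k x).[x] = 0.
Proof.
by case: k => // k _; rewrite /orbit_poly big_ord_recl hornerM /= hornerXsubC subrr mul0r.
Qed.

Section Conjugates.
Variables (K : fieldType) (f : {rmorphism K -> K}) (m : nat) (c : K).
Hypothesis fm : forall z, iter m f z = z.

Lemma conj_inj_of_period :
  (forall k, (0 < k < m)%N -> iter k f c <> c) ->
  forall i j, (i < m)%N -> (j < m)%N -> iter i f c = iter j f c -> i = j.
Proof.
move=> per i j; wlog ij : i j / (i <= j)%N.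
  move=> W im jm e; case: (leqP i j) => ij; first exact: W.
  by apply/esym/W => //; apply: ltnW.
move=> im jm e; apply/eqP; rewrite eqn_leq ij leqNgt; apply/negP => ij'.
apply: (per (j - i)%N); first by rewrite subn_gt0 ij' (leq_ltn_trans (leq_subr _ _)).
have finj : injective (iter i f) := @fmorph_inj _ _ (iter i f).
by apply: finj; rewrite -iterD subnKC.
Qed.

(** Bezout: k is prime to m, so some multiple of k is 1 modulo m, and a c fixed by f^k would be
    fixed by [f]. *)
Lemma prime_period : prime m -> f c <> c -> forall k, (0 < k < m)%N -> iter k f c <> c.
Proof.
move=> pm fc k /andP[k0 km] e; apply: fc.
have ek n : iter (n * k) f c = c by elim: n => // n IHn; rewrite mulSn iterD IHn.
have em n z : iter (n * m) f z = z by elim: n => // n IHn; rewrite mulSn iterD IHn.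
have [u v uv _] := egcdnP m k0; have := ek u; rewrite uv.
have /eqP -> : coprime k m.
  by rewrite coprime_sym prime_coprime //; apply/negP => /dvdn_leq; rewrite k0 leqNgt km; auto.
by rewrite addn1 iterS em.
Qed.

Lemma free_period (Fb : K -> Prop) : (forall z, f z = z <-> Fb z) ->
  (forall a : nat -> K, (forall i, Fb (a i)) ->
      \sum_(i < m) a i * c ^+ i = 0 -> forall i, (i < m)%N -> a i = 0) ->
  forall k, (0 < k < m)%N -> iter k f c <> c.
Proof.
move=> FbP free k /andP[k0 km] e.
pose g := orbit_poly f k c.
have gF i : Fb g`_i by apply/FbP; rewrite -coef_map /= orbit_poly_fixed.
have := free _ gF; rewrite -(horner_coef_wide c (n := m)) ?size_orbit_poly //.
rewrite root_orbit_poly // => /(_ erefl k km) /eqP.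
have := monicP (monic_orbit_poly f k c).
by rewrite lead_coefE size_orbit_poly /= -/g => ->; rewrite oner_eq0.
Qed.
End Conjugates.

(** Multiplication by a nonzero z permutes the nonzero elements; comparing their products shows that
    z is a root of unity of order dividing their number n. A field with n distinct n-th roots of
    unity has a primitive one. *)
Lemma finite_field_primitive (K : fieldType) (s : seq K) : (forall z, z \in s) ->
  exists n (t : K), n.-primitive_root t /\ forall z : K, z != 0 -> exists i, z = t ^+ i.
Proof.
move=> sP; pose u : seq K := undup (filter (predC1 (0 : K)) s).
have uP (z : K) : (z \in u) = (z != 0) by rewrite mem_undup mem_filter sP andbT.
have u1 : (1 : K) \in u by rewrite uP oner_neq0.
have n0 : (0 < size u)%N by case: (u) u1.
have pow (z : K) : z != 0 -> z ^+ size u = 1.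
  move=> z0; have pu : perm_eq (map ( *%R z) u) u.
    apply: uniq_perm; rewrite ?undup_uniq ?map_inj_uniq ?undup_uniq //; first exact: mulfI.
    move=> y; apply/mapP/idP => [[x]|]; rewrite !uP; first by move=> x0 ->; rewrite mulf_neq0.
    move=> y0; exists (z^-1 * y); rewrite ?uP ?mulf_neq0 ?invr_eq0 //.
    by rewrite mulrA mulfV // mul1r.
  have e : \prod_(x <- map ( *%R z) u) x = \prod_(x <- u) x by apply: perm_big.
  rewrite big_map in e.
  have : \prod_(x <- u) x != 0 :> K.
    by rewrite prodf_seq_neq0; apply/allP => x; rewrite uP.
  move/mulIf; apply; rewrite mul1r -[RHS]e big_split /= big_const_seq count_predT.
  by rewrite iter_mulr_1.
have /hasP[t _ tP] : has (size u).-primitive_root u.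
  apply: has_prim_root; rewrite ?undup_uniq //.
  by apply/allP => z; rewrite uP => /pow e; apply/unity_rootP.
exists (size u), t; split=> // z /pow e.
by have [i ->] := prim_rootP tP e; exists i.
Qed.

(* Write m = p^a m' with p not dividing m'. Then (X - z)^m = (X^q - z^q)^m' for
   q = p^a, whose second coefficient is -m' z^q, and z is a power of z^q because
   z has finite order prime to p. *)
Lemma pure_power_coef (K : fieldType) (s : seq K) (p : nat) (P : K -> Prop) (m : nat) (z : K) :
  (forall x, x \in s) -> p \in [pchar K] -> P 1 ->
  (forall x y, P x -> P y -> P (x - y)) -> (forall x y, P x -> P y -> P (x * y)) ->
  (0 < m)%N -> (forall i, P (('X - z%:P) ^+ m)`_i) -> P z.
Proof.
move=> sP pK P1 PB PM m0 Pc.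
have P0 : P 0 by rewrite -(subrr 1); apply: PB.
have PN x : P x -> P (- x) by move=> Px; rewrite -sub0r; apply: PB.
have PD x y : P x -> P y -> P (x + y).
  by move=> Px Py; rewrite -[y]opprK; apply/PB/PN.
have PX x n : P x -> P (x ^+ n) by move=> Px; elim: n => // n IHn; rewrite exprS; apply: PM.
have Pnat n : P n%:R.
  by elim: n => [|n IHn]; rewrite ?mulr0n // mulrSr; apply: PD.
have [n [t [tn tP]]] := finite_field_primitive sP.
have n0 := prim_order_gt0 tn.
have pow (x : K) : x != 0 -> x ^+ n = 1.
  by move=> x0; have [i ->] := tP _ x0; rewrite exprAC (prim_expr_order tn) expr1n.
have [->|z0] := eqVneq z 0; first exact: P0.
have p_pr := pcharf_prime pK.
have pn : coprime p n.
  by rewrite prime_coprime //; apply/negP => /(prim_root_pcharF tn); rewrite pK.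
have mE := partnC p m0; set q := (m`_p)%N in mE; set m' := (m`_p^')%N in mE.
have q0 : (0 < q)%N by apply: part_gt0.
have m'0 : m'%:R != 0 :> K.
  by rewrite -(dvdn_pcharf pK) -prime_coprime // (pnat_coprime (pnat_id p_pr) (part_pnat _ _)).
have m'_gt0 : (0 < m')%N by apply: part_gt0.
have Pzq : P (z ^+ q).
  have qK : [pchar {poly K}].-nat q.
    by rewrite (eq_pnat _ (pchar_poly K)) (eq_pnat _ (pcharf_eq pK)) part_pnat.
  have e : ('X - z%:P) ^+ m = (('X - (z ^+ q)%:P) ^+ m') \Po 'X^q.
    rewrite -mE exprM exprDn_pchar // exprNn_pchar // rmorphXn /= comp_polyB.
    by rewrite comp_polyX comp_polyC polyC_exp.
  (* After the substitution of X^q, this index holds the second coefficient of (X - z^q)^m'. *)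
  have := Pc (q * m'.-1)%N; rewrite e coef_comp_poly_Xn // dvdn_mulr // mulKn //.
  have := @coefPn_prod_XsubC K (nseq m' (z ^+ q)).
  rewrite size_nseq big_nseq iter_mulr_1 -lt0n => -> //.
  rewrite big_nseq iter_addr_0 -mulr_natl => /PN; rewrite opprK => Pm.
  (* [P] is given closed under products only, so dividing by m' is done by multiplying by its power
     n - 1, as m'^n = 1. *)
  have := PM _ _ (PX _ n.-1 (Pnat m')) Pm; rewrite mulrA -exprSr prednK //.
  by rewrite pow // mul1r.
have qn : coprime q n by rewrite /q p_part coprimeXl.
have [w wE] : exists w, (w * q = 1 %[mod n])%N.
  have [u' v' uv' _] := egcdnP n q0; exists u'; rewrite uv' (eqP qn).
  by rewrite -modnDml modnMl.
have -> : z = (z ^+ q) ^+ w; last exact: PX.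
have [i zi] := tP z z0; rewrite -exprM mulnC zi -exprM -[LHS]expr1.
by rewrite -!exprM muln1; apply/eqP; rewrite (eq_prim_root_expr tn) -modnMmr wE modnMmr muln1.
Qed.

(** * Rings of integers *)

Lemma int_subgroup_principal (I : int -> Prop) : I 0 -> (forall x y, I x -> I y -> I (x - y)) ->
  exists2 d, I d & forall z, I z -> exists k, z = k * d.
Proof.
move=> I0 IB; have IN x : I x -> I (- x) by move=> Ix; rewrite -sub0r; apply: IB.
case: (classic (exists2 z, I z & z <> 0)) => [|nz]; last first.
  exists 0 => // z Iz; exists 0; rewrite mul0r; apply: NNPP => z0; apply: nz; by exists z.
have ID x y : I x -> I y -> I (x + y).
  by move=> Ix Iy; rewrite -[y]opprK; apply/IB/IN.
have IM d k : I d -> I (k * d).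
  move=> Id; have Inat n : I (d *+ n).
    by elim: n => [|n IHn]; rewrite ?mulr0n // mulrSr; apply: ID.
  by rewrite mulrC -mulrzz; case: k => n; [|apply: IN]; apply: Inat.
move=> [z Iz z0].
(* The generator is the least positive element of [I]; remainders modulo [d] stay in [I] and so
   vanish. *)
have [d [Id d0 dmin]] : exists d : nat, [/\ I d, (0 < d)%N & forall e : nat, (e < d)%N -> I e -> e = 0%N].
  have : exists2 d : nat, I d & (0 < d)%N.
    by exists `|z|%N; rewrite ?absz_gt0; [case: z Iz {z0} => k Ik //; apply: (IN _ Ik) | apply/eqP].
  move=> [d]; elim/ltn_ind: d => d IHd Id d0.
  case: (classic (exists e : nat, [/\ (e < d)%N, I e & (0 < e)%N])) => [[e [ed Ie e0]]|ne].
    exact: (IHd e).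
  exists d; split=> // e ed Ie; apply/eqP; rewrite -leqn0 leqNgt; apply/negP => e0.
  by apply: ne; exists e.
exists d => // w Iw; exists (w %/ d)%Z.
have dnz : d%:Z != 0 by rewrite -lt0n.
rewrite [LHS](divz_eq w d); have Ir : I (w %% d)%Z.
  by rewrite /modz; apply/IB/IM.
have r0 := modz_ge0 w dnz; have rd : (w %% d < d)%Z by apply: ltz_pmod.
move: (w %% d)%Z r0 rd Ir => [] // r _ rd Ir.
by rewrite (dmin r rd Ir) addr0.
Qed.

Section FinitelyGenerated.
Variable L : fieldExtType rat.

Lemma intr_ext_eq0 (z : int) : (z%:~R == 0 :> L) = (z == 0).
Proof. by rewrite -(rmorph_int (in_alg L)) fmorph_eq0 intr_eq0. Qed.

(** The maps [phi i] embed [P] in Z^N, and the induction peels off one coordinate: the image of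
    [phi N] is some dZ. A lift [g] of d together with generators of the kernel of [phi N], which the
    remaining coordinates separate, generates [P]. *)
Lemma subgroup_fg (phi : nat -> L -> L) (N : nat) (P : L -> Prop) :
  (forall i x y, phi i (x - y) = phi i x - phi i y) ->
  P 0 -> (forall x y, P x -> P y -> P (x - y)) ->
  (forall i x, P x -> exists z : int, phi i x = z%:~R) ->
  (forall x, P x -> (forall i, (i < N)%N -> phi i x = 0) -> x = 0) ->
  exists n (e : 'I_n -> L), (forall i, P (e i)) /\
    forall x, P x -> exists z : 'I_n -> int, x = \sum_(i < n) (z i)%:~R * e i.
Proof.
move=> phiB; elim: N P => [|N IHN] P P0 PB Pint Pinj.
  exists 0%N, (fun=> 0); split=> [[]//|x Px]; exists (fun=> 0).
  by rewrite big_ord0; apply: Pinj.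
have phi0 i : phi i 0 = 0 by have := phiB i 0 0; rewrite !subrr.
have [||d [g [Pg gd]] dP] := @int_subgroup_principal (fun z => exists x, P x /\ phi N x = z%:~R).
- by exists 0; split; rewrite ?phi0.
- by move=> x y [u [Pu eu]] [v [Pv ev]]; exists (u - v); split; [apply: PB|rewrite phiB eu ev rmorphB].
have [||||n [e [Pe eP]]] := IHN (fun x => P x /\ phi N x = 0).
- by split; rewrite ?phi0.
- by move=> x y [Px ex] [Py ey]; split; [apply: PB|rewrite phiB ex ey subrr].
- by move=> i x [Px _]; apply: Pint.
- move=> x [Px ex] xN; apply: Pinj => // i; rewrite ltnS leq_eqVlt => /orP[/eqP -> //|]; exact: xN.
have PN x : P x -> P (- x) by move=> Px; rewrite -sub0r; apply: PB.
have phiN i x : phi i (- x) = - phi i x by rewrite -sub0r phiB phi0 sub0r.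
have PD x y : P x -> P y -> P (x + y).
  by move=> Px Py; rewrite -[y]opprK; apply/PB/PN.
have phiD i x y : phi i (x + y) = phi i x + phi i y by rewrite -{1}[y]opprK phiB phiN opprK.
have PM x (k : int) : P x -> P (k%:~R * x) /\ phi N (k%:~R * x) = k%:~R * phi N x.
  move=> Px; have Pnat j : P (j%:R * x) /\ phi N (j%:R * x) = j%:R * phi N x.
    elim: j => [|j [IH1 IH2]]; first by rewrite !mul0r.
    rewrite -natr1 !mulrDl !mul1r phiD IH2; split=> //; exact: PD.
  case: k => j; first exact: Pnat.
  rewrite NegzE mulrNz !mulNr phiN; case: (Pnat j.+1) => H1 ->; split=> //.
  exact: PN.
exists n.+1, (fun i => if unlift ord0 i is Some j then e j else g); split.
  by move=> i; case: (unliftP ord0 i) => [j _|_] //; have [] := Pe j.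
move=> x Px; have [z ez] := Pint N x Px.
have [k zk] : exists k, z = k * d by apply: dP; exists x.
have [Pkg ekg] := PM g k Pg.
have [|w ew] := eP (x - k%:~R * g).
  by split; [apply: PB | rewrite phiB ekg gd ez zk rmorphM subrr].
exists (fun i => if unlift ord0 i is Some j then w j else k).
rewrite big_ord_recl unlift_none; under eq_bigr => i _ do rewrite liftK.
by rewrite -ew addrC subrK.
Qed.

End FinitelyGenerated.

Lemma map_poly_intr (R S : nzRingType) (f : {rmorphism R -> S}) (p : {poly int}) :
  map_poly f (map_poly intr p) = map_poly intr p.
Proof. by rewrite -map_poly_comp; apply: eq_map_poly => z /=; rewrite rmorph_int. Qed.

Section Integers.
Variable L : fieldExtType rat.
Implicit Types (x y : L) (E : {subfield L}).

Notation integral := (integralOver (intr : int -> L)).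

Lemma rational_integral x : x \in 1%VS -> integral x -> exists z : int, x = z%:~R.
Proof.
move=> /vlineP[r ->] [p pmon]; rewrite -[r *: 1]/(in_alg L r).
rewrite -(map_poly_intr (in_alg L)) fmorph_root => pr.
have ri : (ratr r : algC) \in Aint.
  apply: (@root_monic_Aint (map_poly intr p)); last 1 first.
  - by apply/polyOverP => i; rewrite coef_map /= intr_int.
  - by rewrite -(map_poly_intr (ratr : {rmorphism rat -> algC})) fmorph_root.
  - exact: monic_map.
have /intrP[z ez] : (ratr r : algC) \is a Num.int by apply: Cint_rat_Aint => //; apply: Crat_rat.
exists z; rewrite -(rmorph_int (in_alg L)); congr (in_alg L _).
by apply: (fmorph_inj (ratr : {rmorphism rat -> algC})); rewrite /= ez ratr_int.
Qed.

Lemma integral_multiple x : exists2 n : int, n != 0 & integral (n%:~R * x).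
Proof.
have [q qE] := polyOver1P (minPolyOver 1 x).
have [q' [a a0 q'E]] := rat_poly_scale q.
have q0 : q != 0.
  apply/eqP => q0; have := monic_neq0 (monic_minPoly 1 x).
  by rewrite qE q0 rmorph0 eqxx.
have q'0 : q' != 0 by apply/eqP => e; move: q0; rewrite q'E e rmorph0 scaler0 eqxx.
have rx : (map_poly intr q' : {poly L}).[x] = 0.
  have := root_minPoly 1 x; rewrite qE q'E map_polyZ rootZ; last first.
    by rewrite fmorph_eq0 invr_eq0 intr_eq0.
  by rewrite map_poly_intr => /rootP.
pose b := lead_coef q'; pose d := (size q').-1.
have d0 : (0 < d)%N.
  rewrite lt0n; apply/eqP => d0.
  have sq : (size q' <= 1)%N by rewrite -(prednK (_ : 0 < size q')%N) ?size_poly_gt0 // -/d d0.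
  move: rx; rewrite (size1_polyC sq) map_polyC hornerC /= => /eqP.
  rewrite intr_ext_eq0 => /eqP e; move: q'0; by rewrite (size1_polyC sq) e eqxx.
exists b; first by rewrite lead_coef_eq0.
(* With b the leading coefficient of [q'], this monic polynomial satisfies r(b x) = b^(d-1) q'(x),
   so b x is integral. *)
pose r := 'X^d + \poly_(i < d) (q'`_i * b ^+ (d.-1 - i)).
exists r.
  by rewrite monicE /r lead_coefDl ?lead_coefXn // size_polyXn ltnS size_poly.
apply/rootP; rewrite rmorphD rmorphXn /= map_polyX hornerD hornerXn.
rewrite (@horner_coef_wide _ d); last by rewrite (leq_trans (size_poly _ _)) ?size_poly.
have : (b%:~R ^+ d.-1) * (map_poly intr q' : {poly L}).[x] = 0 by rewrite rx mulr0.
rewrite (@horner_coef_wide _ d.+1); last by rewrite (leq_trans (size_poly _ _)) // /d prednK ?size_poly_gt0.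
rewrite big_ord_recr mulrDr addrC /= => e; rewrite -[RHS]e; congr (_ + _).
  rewrite coef_map /= -/(lead_coef q') -/b exprMn mulrA -exprSr prednK //.
rewrite mulr_sumr; apply: eq_bigr => i _.
rewrite !coef_map /= coef_poly ltn_ord rmorphM rmorphXn /= exprMn.
have -> : (b%:~R ^+ d.-1 = b%:~R ^+ (d.-1 - i) * b%:~R ^+ i :> L).
  by rewrite -exprD subnK //; have := ltn_ord i; lia.
ring.
Qed.

End Integers.

Section Trace.
Variable L : splittingFieldType rat.
Implicit Types (x y : L) (E : {subfield L}).
Notation integral := (integralOver (intr : int -> L)).

Lemma integral_gal E (g : gal_of E) x : integral x -> integral (g x).
Proof.
move=> [p pmon px]; exists p => //.
by rewrite -(map_poly_intr g) fmorph_root.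
Qed.

Lemma galois_rat : galois 1 {:L}.
Proof.
rewrite /galois sub1v /=; apply/andP; split; last exact: normalFieldf.
apply/separableP => y _; apply: pcharf0_separable => p.
by rewrite pchar_lalg pchar_num.
Qed.

Lemma ring_of_integers_fg E : exists n (e : 'I_n -> L), (forall i, ring_of_integers E (e i)) /\
  forall x, ring_of_integers E x -> exists z : 'I_n -> int, x = \sum_(i < n) (z i)%:~R * e i.
Proof.
pose b := vbasis {:L}; pose N := \dim {:L}.
(* The rational basis of L is scaled to integral elements, so that its trace pairings with integral
   elements are rational integers. *)
have [k kP] : exists k : 'I_N -> int, forall i, k i != 0 /\ integral ((k i)%:~R * b`_i).
  apply: (@fin_all_exists _ _ (fun (i : 'I_N) (n : int) => n != 0 /\ integral (n%:~R * b`_i))) => i.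
  by have [n] := integral_multiple b`_i; exists n.
pose Tr : {additive L -> L} := galTrace 1 {:L}.
pose phi i x := if insub i is Some j then Tr (x * ((k j)%:~R * b`_j)) else 0.
apply: (@subgroup_fg L phi N).
- move=> i x y; rewrite /phi; case: insub => [j|]; last by rewrite subrr.
  by rewrite mulrBl raddfB.
- by split; [apply: mem0v | apply: integral0].
- by move=> x y [xE ix] [yE iy]; split; [apply: rpredB | apply: integral_sub].
- move=> i x [xE ix]; rewrite /phi; case: insub => [j|]; last by exists 0.
  apply: rational_integral; first by apply: mem_galTrace; rewrite ?memvf ?galois_rat.
  rewrite /Tr /= /galTrace; apply: big_ind => [||g _]; first exact: integral0.
    by move=> u v; apply: integral_add.
  by apply/integral_gal/integral_mul => //; have [] := kP j.
move=> x [_ ix] x0.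
have TrZ a y : Tr (a *: y) = a *: Tr y.
  by rewrite /Tr /galTrace scaler_sumr; apply: eq_bigr => g _; rewrite linearZ.
have Tr0 y : Tr (x * y) = 0.
  have -> : y = \sum_(i < N) coord b i y *: b`_i by apply: coord_vbasis; rewrite memvf.
  rewrite mulr_sumr raddf_sum big1 // => i _.
  have := x0 i (ltn_ord i); rewrite /phi valK; have [ki _] := kP i.
  rewrite mulrCA mulrzl -scaler_int TrZ => /eqP.
  by rewrite scaler_eq0 intr_eq0 (negbTE ki) /= => /eqP e; rewrite -scalerAr TrZ /= e scaler0.
(* An x orthogonal to the basis satisfies Tr(x y) = 0 for all y. For nonzero x, taking y = x^-1
   gives Tr(1) = 0, but Tr(1) is the order of the Galois group. *)
apply/eqP; apply: contraT => xn0; have := Tr0 x^-1; rewrite mulfV //.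
rewrite /Tr /= /galTrace; under eq_bigr => g _ do rewrite rmorph1.
rewrite sumr_const => /eqP.
by rewrite pmulrn intr_ext_eq0 eqz_nat eqn0Ngt cardG_gt0.
Qed.
End Trace.

Section RingOfIntegers.
Variables (L : fieldExtType rat) (E : {subfield L}).
Notation O := (ring_of_integers E).

Lemma ring_of_integers_int (z : int) : O z%:~R.
Proof. by split; [apply: rpred_int | apply: (integral_id (intr : {rmorphism int -> L}))]. Qed.

Lemma ring_of_integers_nat (n : nat) : O n%:R. Proof. exact: (ring_of_integers_int n). Qed.
Lemma ring_of_integers0 : O 0. Proof. exact: (ring_of_integers_int 0). Qed.
Lemma ring_of_integers1 : O 1. Proof. exact: (ring_of_integers_int 1). Qed.

Lemma ring_of_integersD x y : O x -> O y -> O (x + y).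
Proof. by move=> [xE ix] [yE iy]; split; [apply: rpredD | apply: integral_add]. Qed.

Lemma ring_of_integersN x : O x -> O (- x).
Proof. by move=> [xE ix]; split; [rewrite rpredN | apply: integral_opp]. Qed.

Lemma ring_of_integersB x y : O x -> O y -> O (x - y).
Proof. by move=> Ox Oy; apply/ring_of_integersD/ring_of_integersN. Qed.

Lemma ring_of_integersM x y : O x -> O y -> O (x * y).
Proof. by move=> [xE ix] [yE iy]; split; [apply: rpredM | apply: integral_mul]. Qed.

Lemma ring_of_integers_sum (I : Type) (r : seq I) (P : pred I) (G : I -> L) :
  (forall i, P i -> O (G i)) -> O (\sum_(i <- r | P i) G i).
Proof.
move=> OG; apply: big_ind => //; [exact: ring_of_integers0 | exact: ring_of_integersD].
Qed.

End RingOfIntegers.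

Section Ideals.
Variables (L : fieldType) (O I : L -> Prop).
Hypothesis idI : is_ideal O I.

Lemma ideal0 : I 0. Proof. by case: idI => _ []. Qed.
Lemma idealN x : I x -> I (- x).
Proof. by case: idI => _ [I0 [IB _]] Ix; rewrite -sub0r; apply: IB. Qed.
Lemma idealD x y : I x -> I y -> I (x + y).
Proof. by case: (idI) => _ [_ [IB _]] Ix Iy; rewrite -[y]opprK; apply/IB/idealN. Qed.
Lemma idealMl a x : O a -> I x -> I (a * x).
Proof. by case: idI => _ [_ [_]]; apply. Qed.
Lemma ideal_sum (J : Type) (r : seq J) (P : pred J) (G : J -> L) :
  (forall i, P i -> I (G i)) -> I (\sum_(i <- r | P i) G i).
Proof. by move=> IG; apply: big_ind => //; [exact: ideal0 | exact: idealD]. Qed.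
End Ideals.

(** The integer is the norm of x from L to Q up to sign. The cofactor N / x is a product of
    conjugates, hence integral, and lies in E because N is rational; so N is in the ideal. *)
Lemma nonzero_ideal_int (L : splittingFieldType rat) (E : {subfield L}) (q : L -> Prop) x :
  is_ideal (ring_of_integers E) q -> q x -> x != 0 ->
  exists2 n : nat, (0 < n)%N & q n%:R.
Proof.
move=> iq qx x0; have [xE ix] : ring_of_integers E x by case: iq => + _; apply.
pose N := galNorm 1 {:L} x.
have intG (g : gal_of {:L}) : integralOver (intr : int -> L) (g x) by apply: integral_gal.
have N0 : N != 0 by rewrite galNorm_eq0.
have [z zE] : exists z : int, N = z%:~R.
  apply: rational_integral; first by apply: mem_galNorm; rewrite ?memvf ?galois_rat.
  rewrite /N /galNorm; apply: big_ind => [||g _] //; first exact: integral1.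
  by move=> u v; apply: integral_mul.
have qN : q N.
  rewrite -[N](mulfVK x0); apply: (idealMl iq) qx; split.
    by rewrite rpred_div // zE rpred_int.
  rewrite /N /galNorm (bigD1 1%g) ?group1 //= gal_id mulrAC mulfV // mul1r.
  by apply: big_ind => [||g _] //; [exact: integral1 | move=> u v; apply: integral_mul].
exists `|z|%N; first by rewrite absz_gt0 -(intr_ext_eq0 L) -zE.
move: qN; rewrite zE; case: z zE => // k _ qk.
by have := idealN iq qk; rewrite NegzE mulrNz opprK.
Qed.

Lemma det_congr (L : fieldType) (O I : L -> Prop) n (A B : 'M[L]_n) :
  is_ideal O I -> O 1 -> (forall x, O x -> O (- x)) -> (forall x y, O x -> O y -> O (x * y)) ->
  (forall i j, O (A i j)) -> (forall i j, O (B i j)) -> (forall i j, I (A i j - B i j)) ->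
  I (\det A - \det B).
Proof.
move=> idI O1 ON OM OA OB AB; rewrite /determinant -sumrB; apply: (ideal_sum idI) => s _.
rewrite -mulrBr; apply: (idealMl idI); first by case: (odd_perm s); rewrite ?expr1 ?expr0 //; apply: ON.
suff [] : [/\ I (\prod_i A i (s i) - \prod_i B i (s i)) , O (\prod_i A i (s i)) & O (\prod_i B i (s i))] by [].
apply: (big_rec2 (fun x y => [/\ I (x - y), O x & O y])); first by rewrite subrr; split=> //; apply: ideal0 idI.
move=> i x y _ [Ixy Ox Oy]; split; try exact: OM.
have -> : A i (s i) * x - B i (s i) * y = x * (A i (s i) - B i (s i)) + B i (s i) * (x - y) by ring.
by apply: (idealD idI); apply: (idealMl idI).
Qed.

Lemma det_rpred (R : comNzRingType) (S : subringClosed R) n (A : 'M[R]_n) :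
  (forall i j, A i j \in S) -> \det A \in S.
Proof. by move=> AS; apply: rpred_sum => s _; rewrite rpredMsign rpred_prod. Qed.

Lemma adj_rpred (R : comNzRingType) (S : subringClosed R) n (A : 'M[R]_n) :
  (forall i j, A i j \in S) -> forall i j, (\adj A) i j \in S.
Proof.
move=> AS i j; rewrite mxE /cofactor rpredMsign det_rpred // => k l.
by rewrite !mxE.
Qed.

(* Nakayama's lemma in determinant form: writing generators e of O_K over Z as
   e = a x + U e with U over q, the determinant of 1 - U lies in 1 + q, so it is
   nonzero and multiplies O_K into the F-span of the x_i. *)
Lemma dim_le_residue_span (L : splittingFieldType rat) (F K : {subfield L}) (q : L -> Prop)
    (d : nat) (x : 'I_d -> L) :
  (F <= K)%VS -> is_ideal (ring_of_integers F) q -> ~ q 1 ->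
  (forall y, ring_of_integers K y -> exists a : 'I_d -> L,
     (forall i, ring_of_integers F (a i)) /\
     ext_ideal q (ring_of_integers K) (y - \sum_i a i * x i)) ->
  (\dim_F K <= d)%N.
Proof.
move=> FK iq q1 spanx; have [n [e [eO eP]]] := ring_of_integers_fg K.
pose W := (\sum_(i < d) F * <[x i]>)%VS.
have WF a w : a \in F -> w \in W -> a * w \in W.
  move=> aF; suff sW : (F * W <= W)%VS by move=> wW; apply: (subvP sW); apply: memv_mul.
  rewrite /W big_distrr /=; apply/subv_sumP => i _; rewrite prodvA prodv_id.
  exact: sumv_sup (subvv _).
have qO a : q a -> ring_of_integers F a by case: iq => + _; apply.
have [U [Uq UW]] : exists U : 'M[L]_n, (forall i j, q (U i j)) /\
    forall i, e i - \sum_j U i j * e j \in W.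
  have [u uP] : exists u : 'I_n -> 'I_n -> L, forall i, (forall j, q (u i j)) /\
      e i - \sum_j u i j * e j \in W.
    apply: (@fin_all_exists _ _ (fun (i : 'I_n) (u : 'I_n -> L) => (forall j, q (u j)) /\
      e i - \sum_j u j * e j \in W)) => i.
    have [a [aO [s [sq sE]]]] := spanx _ (eO i).
    (* The error term is a sum of products of an element of [q] and one of O_K; expanding the latter
       in the generators [e] collects coefficients in [q]. *)
    have [v vE] : exists v : 'I_(size s) -> 'I_n -> int, forall k : 'I_(size s),
        (nth (0, 0) s k).2 = \sum_(j < n) (v k j)%:~R * e j.
      apply: (@fin_all_exists _ _ (fun (k : 'I_(size s)) (v : 'I_n -> int) =>
        (nth (0, 0) s k).2 = \sum_(j < n) (v j)%:~R * e j)) => k.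
      by apply: eP; have [] := sq _ (mem_nth (0, 0) (ltn_ord k)).
    exists (fun j => \sum_(k < size s) (v k j)%:~R * (nth (0, 0) s k).1); split.
      move=> j; apply: (ideal_sum iq) => k _; apply: (idealMl iq).
        exact: ring_of_integers_int.
      by have [] := sq _ (mem_nth (0, 0) (ltn_ord k)).
    have -> : \sum_(j < n) (\sum_(k < size s) (v k j)%:~R * (nth (0, 0) s k).1) * e j =
        e i - \sum_i a i * x i.
      rewrite sE (big_nth (0, 0)) big_mkord.
      under eq_bigr => j _ do rewrite mulr_suml.
      rewrite exchange_big /=; apply: eq_bigr => k _; rewrite vE mulr_sumr.
      by apply: eq_bigr => j _; ring.
    rewrite subKr; apply: rpred_sum => l _.
    apply: (subvP (sumv_sup l _ (subvv _))) => //.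
    by apply: memv_mul; rewrite ?memv_line //; case: (aO l).
  exists (\matrix_(i, j) u i j); split=> [i j|i]; first by rewrite mxE; case: (uP i).
  by under eq_bigr => j _ do rewrite mxE; case: (uP i).
pose D := 1%:M - U.
have DF i j : D i j \in F.
  by rewrite !mxE rpredB ?rpred_nat //; have [] := qO _ (Uq i j).
(* D is congruent to the identity modulo [q], so det D = 0 would put 1 in [q]. *)
have detD : \det D != 0.
  apply/eqP => D0; apply: q1; rewrite -(det1 L n) -[\det 1%:M]subr0 -D0.
  apply: (@det_congr _ (ring_of_integers F)) => //.
  - exact: ring_of_integers1.
  - exact: ring_of_integersN.
  - exact: ring_of_integersM.
  - by move=> i j; rewrite mxE; apply: ring_of_integers_nat.
  - move=> i j; rewrite !mxE; apply: ring_of_integersB; last exact: qO.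
    exact: ring_of_integers_nat.
  - by move=> i j; rewrite !mxE subKr.
pose ev := \col_i e i.
have Dev i : (D *m ev) i 0 \in W.
  rewrite mulmxBl mul1mx !mxE; under eq_bigr => j _ do rewrite mxE.
  exact: UW.
have eW i : e i \in W.
  (* Cramer's rule: [W] contains det D times each generator, and det D is a nonzero element of F. *)
  have : (\adj D *m (D *m ev)) i 0 \in W.
    by rewrite mxE; apply: rpred_sum => j _; apply: WF => //; apply: adj_rpred.
  rewrite mulmxA mul_adj_mx mul_scalar_mx !mxE => dW.
  rewrite -[e i](mulKf detD); apply: WF => //.
  by rewrite rpredV det_rpred.
have KW : (K <= W)%VS.
  (* Every element of K has a nonzero integer multiple in O_K, so the generators [e] span K over
     Q. *)
  apply/subvP => y yK; have [k k0 ky] := integral_multiple y.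
  have k0' : k%:~R != 0 :> L by rewrite intr_ext_eq0.
  have [z zE] : exists z : 'I_n -> int, k%:~R * y = \sum_(i < n) (z i)%:~R * e i.
    by apply: eP; split=> //; rewrite rpredM ?rpred_int.
  rewrite -[y](mulKf k0') zE; apply: (WF _ _); first by rewrite rpredV rpred_int.
  by apply: rpred_sum => i _; apply: WF (eW i); rewrite rpred_int.
have dW : (\dim W <= d * \dim F)%N.
  apply: leq_trans (dimv_leq_sum _ _ _) _.
  rewrite -[d in leqRHS]card_ord -sum_nat_const; apply: leq_sum => i _.
  apply: leq_trans (dim_prodv _ _) _; rewrite dim_vline.
  by case: (x i != 0); rewrite ?muln1 ?muln0.
rewrite -(mulnK d (adim_gt0 F)); apply: leq_div2r.
exact: leq_trans (dimvS KW) dW.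
Qed.

(** * The residue field *)

(** Makes the ring morphism theory available for the induced map on residues, which is given as a
    plain function. *)
Lemma rmorph_of_fun (R S : pzRingType) (g : R -> S) :
  (forall x y, g (x + y) = g x + g y) -> (forall x y, g (x * y) = g x * g y) -> g 1 = 1 ->
  exists f : {rmorphism R -> S}, g = f.
Proof.
move=> gD gM g1; have g0 : g 0 = 0 by apply: (addIr (g 0)); rewrite -gD !add0r.
have gB : zmod_morphism g.
  move=> x y; apply: (addIr (g y)); by rewrite -gD !subrK.
have gm : monoid_morphism g by split.
pose A := GRing.isZmodMorphism.Build R S g gB.
pose M := GRing.isMonoidMorphism.Build R S g gm.
pose f : {rmorphism R -> S} := HB.pack g A M.
by exists f.
Qed.

Section ResidueField.
Variables (L : splittingFieldType rat) (F K : {subfield L}) (sigma : gal_of K) (m : nat).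
Variables (q : L -> Prop).
Hypothesis FK : (F <= K)%VS.
Hypothesis galFK : galois F K.
Hypothesis gen_sigma : 'Gal(K / F)%g = <[sigma]>%g.
Hypothesis mE : m = (\dim_F K)%N.
Hypothesis q_prime : is_prime_ideal (ring_of_integers F) q.
Hypothesis q_nz : exists x, q x /\ x <> 0.
Hypothesis Q_prime : is_prime_ideal (ring_of_integers K) (ext_ideal q (ring_of_integers K)).

Local Notation OK := (ring_of_integers K).
Local Notation OF := (ring_of_integers F).
Local Notation Q := (ext_ideal q OK).

Variables (Kb : fieldType) (pi : L -> Kb) (sigmab : {rmorphism Kb -> Kb}).
Hypothesis piD : forall x y, OK x -> OK y -> pi (x + y) = pi x + pi y.
Hypothesis piM : forall x y, OK x -> OK y -> pi (x * y) = pi x * pi y.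
Hypothesis pi1 : pi 1 = 1.
Hypothesis pi_surj : forall z, exists x, OK x /\ pi x = z.
Hypothesis pi_ker : forall x, OK x -> (pi x = 0 <-> Q x).
Hypothesis sigmab_pi : forall u, OK u -> sigmab (pi u) = pi (sigma u).

Let Fb := fun z : Kb => exists x, OF x /\ pi x = z.

Lemma OF_OK x : OF x -> OK x.
Proof. by case=> xF ix; split=> //; apply: (subvP FK). Qed.

Lemma residue0 : pi 0 = 0.
Proof. by apply: (addIr (pi 0)); rewrite -piD ?add0r //; apply: ring_of_integers0. Qed.

Lemma residueN x : OK x -> pi (- x) = - pi x.
Proof.
move=> Ox; apply/eqP; rewrite -addr_eq0 -piD ?addNr ?residue0 //.
exact: ring_of_integersN.
Qed.

Lemma residueB x y : OK x -> OK y -> pi (x - y) = pi x - pi y.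
Proof. by move=> Ox Oy; rewrite piD ?residueN //; apply: ring_of_integersN. Qed.

Lemma residue_sum (I : Type) (r : seq I) (P : pred I) (G : I -> L) :
  (forall i, P i -> OK (G i)) -> pi (\sum_(i <- r | P i) G i) = \sum_(i <- r | P i) pi (G i).
Proof.
move=> OG; suff [] : OK (\sum_(i <- r | P i) G i) /\
  pi (\sum_(i <- r | P i) G i) = \sum_(i <- r | P i) pi (G i) by [].
apply: (big_rec2 (fun x y => OK x /\ pi x = y)); first by split; [exact: ring_of_integers0|exact: residue0].
move=> i x y Pi [Ox <-]; split; first by apply: ring_of_integersD => //; apply: OG.
by rewrite piD //; apply: OG.
Qed.

Lemma residue_nat n : pi n%:R = n%:R.
Proof.
elim: n => [|n IHn]; first exact: residue0.
by rewrite -!natr1 piD ?IHn ?pi1 //; [exact: ring_of_integers_nat | exact: ring_of_integers1].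
Qed.

Lemma residue_int (z : int) : pi z%:~R = z%:~R.
Proof.
case: z => n; first exact: residue_nat.
by rewrite NegzE !mulrNz residueN ?residue_nat //; apply: ring_of_integers_nat.
Qed.

Lemma sigma_OK x : OK x -> OK (sigma x).
Proof. by move=> [xK ix]; split; [apply: memv_gal | apply: integral_gal]. Qed.

Lemma iter_sigma_OK i x : OK x -> OK (iter i sigma x).
Proof. by move=> Ox; elim: i => //= i; apply: sigma_OK. Qed.

Lemma residue_iter i x : OK x -> iter i sigmab (pi x) = pi (iter i sigma x).
Proof. by move=> Ox; elim: i => //= i ->; rewrite sigmab_pi //; apply: iter_sigma_OK. Qed.

Lemma degree_gt0 : (0 < m)%N.
Proof. by rewrite mE divn_gt0 ?adim_gt0 // dimvS. Qed.

Lemma iter_sigma_gal k x : x \in K -> (sigma ^+ k)%g x = iter k sigma x.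
Proof.
move=> xK; elim: k => [|k IHk]; first exact: gal_id.
by rewrite expgSr galM // IHk.
Qed.

Lemma sigma_period x : x \in K -> iter m sigma x = x.
Proof.
move=> xK; rewrite -iter_sigma_gal // mE (galois_dim galFK) gen_sigma -/#[sigma]%g expg_order.
exact: gal_id.
Qed.

Lemma sigma_fixed x : x \in K -> sigma x = x -> x \in F.
Proof.
move=> xK sx; rewrite -(galois_fixedField galFK) gen_sigma.
apply/fixedFieldP => // _ /cycleP[k ->]; rewrite iter_sigma_gal //.
by elim: k => //= k ->.
Qed.

Lemma sigma_fix x : x \in F -> sigma x = x.
Proof. by move=> xF; apply: (fixed_gal FK) => //; rewrite gen_sigma cycle_id. Qed.

Lemma sigmab_period z : iter m sigmab z = z.
Proof.
by have [x [Ox <-]] := pi_surj z; rewrite residue_iter // sigma_period //; case: Ox.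
Qed.

Lemma residue_nonzero_nat : exists2 n : nat, (0 < n)%N & n%:R = 0 :> Kb.
Proof.
have [x [qx x0]] := q_nz; have [iq _] := q_prime.
have [n n0 qn] : exists2 n : nat, (0 < n)%N & q n%:R.
  by apply: (nonzero_ideal_int iq qx); apply/eqP.
exists n => //; rewrite -residue_nat; apply/pi_ker; first exact: ring_of_integers_nat.
exists [:: (n%:R, 1)]; rewrite big_seq1 mulr1; split=> // u; rewrite inE => /eqP -> /=.
by split=> //; apply: ring_of_integers1.
Qed.

Lemma residue_field_finite : exists s : seq Kb, forall z, z \in s.
Proof.
have [n [e [eO eP]]] := ring_of_integers_fg K.
have [[|N] // _ N0] := residue_nonzero_nat.
(* O_K is generated over Z by the [e j], and the positive integer [N.+1] vanishes in the residue
   field, so coefficients matter only modulo [N.+1]. *)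
exists [seq \sum_(j < n) (t j)%:R * pi (e j) | t : {ffun 'I_n -> 'I_N.+1}] => z.
have [x [Ox <-]] := pi_surj z; have [v ->] := eP x Ox.
apply/imageP; exists [ffun j => inord `|(v j %% N.+1)%Z|%N] => //.
rewrite residue_sum => [|j _]; last by apply: ring_of_integersM => //; apply: ring_of_integers_int.
apply: eq_bigr => j _; rewrite piM ?residue_int //; last exact: ring_of_integers_int.
congr (_ * _); rewrite ffunE inordK; last first.
  by rewrite -ltz_nat gez0_abs ?modz_ge0 // ltz_pmod.
rewrite {1}(divz_eq (v j) N.+1) rmorphD rmorphM /= pmulrn.
by rewrite gez0_abs ?modz_ge0 // -[(N.+1)%:~R]/(N.+1%:R) N0 mulr0 add0r.
Qed.

(** [pi] respects sums and products on O_K only, so integrality of the coefficients and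
    compatibility with reduction are carried through one induction. *)
Lemma residue_prod_XsubC n (x : 'I_n -> L) : (forall i, OK (x i)) ->
  (forall k, OK (\prod_(i < n) ('X - (x i)%:P))`_k) /\
  map_poly pi (\prod_(i < n) ('X - (x i)%:P)) = \prod_(i < n) ('X - (pi (x i))%:P).
Proof.
move=> Ox.
apply: (big_rec2 (fun (p : {poly L}) (r : {poly Kb}) => (forall k, OK p`_k) /\ map_poly pi p = r)).
  split=> [k|]; first by rewrite coefC; case: eqP => _; [exact: ring_of_integers1|exact: ring_of_integers0].
  apply/polyP=> k; rewrite coef_map_id0 ?residue0 // !coefC.
  by case: eqP; rewrite ?pi1 ?residue0.
move=> i p _ _ [Op <-]; have coefE k : (('X - (x i)%:P) * p)`_k =
    (if k is k'.+1 then p`_k' else 0) - x i * p`_k.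
  by rewrite mulrBl coefB coefXM coefCM; case: k.
have Op' k : OK (if k is k'.+1 then p`_k' else 0).
  by case: k => [|k]; [exact: ring_of_integers0 | exact: Op].
have Oxp k : OK (x i * p`_k) by apply: ring_of_integersM.
split=> [k|]; first by rewrite coefE; apply: ring_of_integersB.
apply/polyP=> k; rewrite coef_map_id0 ?residue0 // coefE residueB // piM //.
rewrite mulrBl coefB coefXM coefCM; congr (_ - _); last by rewrite coef_map_id0 ?residue0.
by case: k => [|k]; rewrite ?residue0 // coef_map_id0 ?residue0.
Qed.

Lemma sigmab_fixed z : sigmab z = z <-> Fb z.
Proof.
split=> [sz|[x [[xF ix] <-]]]; last first.
  by rewrite sigmab_pi ?sigma_fix //; apply: OF_OK.
have [s sP] := residue_field_finite.
have [n n0 nK] := residue_nonzero_nat.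
have [p pK] := natf0_pchar n0 (introT eqP nK).
(* Here P is membership in F-bar. The coefficients of (X - z)^m are the reductions of those of the
   orbit polynomial of a lift of z, which are integral and fixed by sigma, hence in O_F. *)
apply: (pure_power_coef sP pK (m := m)).
- by exists 1; split=> //; apply: ring_of_integers1.
- move=> _ _ [a [Oa <-]] [b [Ob <-]]; exists (a - b).
  by rewrite residueB; [split=> //; apply: ring_of_integersB | apply: OF_OK | apply: OF_OK].
- move=> _ _ [a [Oa <-]] [b [Ob <-]]; exists (a * b).
  by rewrite piM; [split=> //; apply: ring_of_integersM | apply: OF_OK | apply: OF_OK].
- exact: degree_gt0.
move=> k; have [x [Ox zE]] := pi_surj z.
have [Og gE] := @residue_prod_XsubC m (fun i => iter i sigma x) (fun i => iter_sigma_OK i Ox).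
exists (orbit_poly sigma m x)`_k; split.
  have [gK ig] := Og k; split=> //; apply: sigma_fixed => //.
  by rewrite -/(orbit_poly _ _ _) -coef_map /= orbit_poly_fixed // sigma_period //; case: Ox.
rewrite -coef_map_id0 ?residue0 // gE; congr (_`_k).
under eq_bigr => i _ do rewrite -residue_iter // zE.
rewrite (eq_bigr (fun=> 'X - z%:P)) ?prodr_const ?card_ord // => i _.
by congr (_ - _%:P); elim: (i : nat) => //= j ->.
Qed.

Lemma sigmab_faithful k : (0 < k < m)%N -> exists z, iter k sigmab z <> z.
Proof.
move=> /andP[k0 km]; apply: NNPP => nz.
have fk z : iter k sigmab z = z by apply: NNPP => kz; apply: nz; exists z.
have [s sP] := residue_field_finite.
have [_ [t [_ tP]]] := finite_field_primitive sP.
have FbB x y : Fb x -> Fb y -> Fb (x - y).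
  by move=> /sigmab_fixed Fx /sigmab_fixed Fy; apply/sigmab_fixed; rewrite rmorphB Fx Fy.
have FbM x y : Fb x -> Fb y -> Fb (x * y).
  by move=> /sigmab_fixed Fx /sigmab_fixed Fy; apply/sigmab_fixed; rewrite rmorphM Fx Fy.
have Fb0 : Fb 0 by apply/sigmab_fixed; rewrite rmorph0.
have Fb1 : Fb 1 by apply/sigmab_fixed; rewrite rmorph1.
(* The F-bar-span of 1, t, ..., t^(k-1), where t generates the multiplicative group. It is shown to
   be the whole residue field. *)
pose S y := exists a : 'I_k -> Kb, (forall i, Fb (a i)) /\ y = \sum_i a i * t ^+ i.
have S0 : S 0 by exists (fun=> 0); split=> //; rewrite big1 // => i _; rewrite mul0r.
have SB x y : S x -> S y -> S (x - y).
  move=> [a [Fa ->]] [b [Fbb ->]]; exists (fun i => a i - b i); split; first by move=> i; apply: FbB.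
  by rewrite -sumrB; apply: eq_bigr => i _; rewrite mulrBl.
have SM a y : Fb a -> S y -> S (a * y).
  move=> Fa [b [Fbb ->]]; exists (fun i => a * b i); split; first by move=> i; apply: FbM.
  by rewrite mulr_sumr; apply: eq_bigr => i _; rewrite mulrA.
have Ssum (I : finType) (G : I -> Kb) : (forall i, S (G i)) -> S (\sum_i G i).
  move=> SG; apply: big_ind => // x y Sx Sy; rewrite -[y]opprK -[- y]sub0r.
  by apply: (SB) => //; apply: (SB).
have Slow i : (i < k)%N -> S (t ^+ i).
  move=> ik; exists (fun j => (j == i :> nat)%:R); split.
    by move=> j; case: (_ == _).
  rewrite (bigD1 (Ordinal ik)) //= eqxx mul1r big1 ?addr0 // => j ji.
  by rewrite (_ : _ == _ = false) ?mul0r //; apply/negbTE.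
(* As sigma-bar^k is trivial, the orbit polynomial of length k has coefficients in F-bar; it is
   monic with root t and so reduces t^k to lower powers. *)
have Stop : S (t ^+ k).
  pose g := orbit_poly sigmab k t.
  have gF i : Fb g`_i by apply/sigmab_fixed; rewrite -coef_map /= orbit_poly_fixed.
  have := root_orbit_poly sigmab t k0; rewrite (@horner_coef_wide _ k.+1) ?size_orbit_poly //.
  have := monicP (monic_orbit_poly sigmab k t); rewrite lead_coefE size_orbit_poly /= => gk.
  rewrite big_ord_recr /= gk mul1r addrC => /eqP; rewrite addr_eq0 -sub0r => /eqP ->.
  by apply: (SB) => //; apply: Ssum => i; apply: (SM) => //; apply: Slow.
have St j : S (t ^+ j).
  elim: j => [|j [a [Fa ta]]]; first exact: Slow.
  rewrite exprS ta mulr_sumr; apply: Ssum => i; rewrite mulrCA -exprS; apply: (SM) => //.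
  by have := ltn_ord i; rewrite leq_eqVlt => /orP[/eqP -> //|]; apply: Slow.
have SK z : S z.
  by have [->//|z0] := eqVneq z 0; have [j ->] := tP z z0.
have [x xP] : exists x : 'I_k -> L, forall i : 'I_k, OK (x i) /\ pi (x i) = t ^+ i.
  apply: (@fin_all_exists _ _ (fun (i : 'I_k) y => OK y /\ pi y = t ^+ i)) => i.
  exact: pi_surj.
(* Lifts of the powers of t span O_K over O_F modulo [Q], which bounds the degree by k < m. *)
have : (\dim_F K <= k)%N; last by rewrite -mE leqNgt km.
have [iq [[u [Ou nu]] _]] := q_prime.
apply: (@dim_le_residue_span _ _ _ q k x) => //.
  by move=> q1; apply: nu; rewrite -[u]mulr1; apply: (idealMl iq).
move=> y Oy; have [a [Fa ya]] := SK (pi y).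
have [b bP] : exists b : 'I_k -> L, forall i : 'I_k, OF (b i) /\ pi (b i) = a i.
  exact: (@fin_all_exists _ _ (fun (i : 'I_k) y => OF y /\ pi y = a i)).
exists b; split=> [i|]; first by case: (bP i).
have Obx i : OK (b i * x i).
  by have [? _] := bP i; have [? _] := xP i; apply: ring_of_integersM => //; apply: OF_OK.
apply/pi_ker; first by apply: ring_of_integersB => //; apply: ring_of_integers_sum.
rewrite residueB //; last exact: ring_of_integers_sum.
rewrite residue_sum // ya; apply/eqP; rewrite subr_eq0; apply/eqP/eq_bigr => i _.
by have [Ob <-] := bP i; have [Ox <-] := xP i; rewrite piM //; apply: OF_OK.
Qed.

(** * Coefficientwise reduction of the natural order *)

Section Reduction.
Variable c : L.
Hypothesis Oc : OK c.

Local Notation Lam := (petit_carrier OK m).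
Local Notation mulL := (petit_mul sigma m c).
Local Notation mulb := (petit_mul sigmab m (pi c)).
Local Notation qLam := (ideal_times q Lam).

Lemma coef_reduction (l : {poly L}) k : (map_poly pi l)`_k = pi l`_k.
Proof. by rewrite coef_map_id0 ?residue0. Qed.

Lemma size_reduction (l : {poly L}) : (size l <= m)%N -> (size (map_poly pi l) <= m)%N.
Proof. by move=> sl; rewrite (leq_trans (size_poly _ _)). Qed.

Lemma reduction_surj (b : {poly Kb}) : (size b <= m)%N -> exists l, Lam l /\ map_poly pi l = b.
Proof.
move=> sb.
have [x xP] : exists x : 'I_m -> L, forall i : 'I_m, OK (x i) /\ pi (x i) = b`_i.
  apply: (@fin_all_exists _ _ (fun (i : 'I_m) y => OK y /\ pi y = b`_i)) => i.
  exact: pi_surj.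
exists (\poly_(i < m) if insub i is Some j then x j else 0); split.
  split=> [|i]; first exact: size_poly.
  rewrite coef_poly; case: ifP => [im|_]; last exact: ring_of_integers0.
  by rewrite insubT; case: (xP (Sub i im)).
apply/polyP => i; rewrite coef_reduction coef_poly; case: ltnP => [im|mi].
  by rewrite insubT; case: (xP (Sub i im)).
by rewrite residue0 nth_default // (leq_trans sb).
Qed.

Lemma reductionD l l' : Lam l -> Lam l' -> map_poly pi (l + l') = map_poly pi l + map_poly pi l'.
Proof. by move=> [_ Ol] [_ Ol']; apply/polyP=> k; rewrite coefD !coef_reduction coefD piD. Qed.

Lemma reductionZ a l : OK a -> Lam l -> map_poly pi (a *: l) = pi a *: map_poly pi l.
Proof. by move=> Oa [_ Ol]; apply/polyP=> k; rewrite coefZ !coef_reduction coefZ piM. Qed.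

Lemma Lam_summand g h k (i : 'I_m) : Lam g -> Lam h ->
  OK (if (i <= k)%N then iter i sigma h`_(k - i) else iter i sigma h`_(m + k - i) * iter k sigma c).
Proof.
move=> [_ Og] [_ Oh]; case: ifP => _; first exact: iter_sigma_OK.
by apply: ring_of_integersM; apply: iter_sigma_OK.
Qed.

Lemma reductionM l l' : Lam l -> Lam l' ->
  map_poly pi (mulL l l') = mulb (map_poly pi l) (map_poly pi l').
Proof.
move=> Ll Ll'; have [[sl Ol] [sl' Ol']] := (Ll, Ll'); apply/polyP=> k.
rewrite coef_reduction !coef_petit_mul ?rmorph0 ?size_reduction //.
case: ifP => km; last exact: residue0.
rewrite residue_sum => [|i _]; last by apply: ring_of_integersM => //; apply: Lam_summand Ll Ll'.
apply: eq_bigr => i _; rewrite piM //; last exact: Lam_summand Ll Ll'.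
rewrite !coef_reduction; congr (_ * _); case: ifP => _; first by rewrite residue_iter.
by rewrite piM ?residue_iter //; apply: iter_sigma_OK.
Qed.

(** This is the decomposition of q Lambda as the direct sum of the q O_K t^j. For the converse, each
    coefficient, a sum of products from [q] and O_K, is distributed over its monomial. *)
Lemma qLamP l : qLam l <-> Lam l /\ forall j, Q l`_j.
Proof.
have [iQ _] := Q_prime; have [iq _] := q_prime; split=> [[s [sq ->]]|[[sl Ol] Ql]].
  have Os u : u \in s -> Lam (u.1 *: u.2).
    move=> /sq[qu [su Ou]]; split; first by rewrite (leq_trans (size_scale_leq _ _)).
    move=> i; rewrite coefZ; apply: ring_of_integersM => //; apply: OF_OK.
    by case: iq => + _; apply.
  split; last first.
    move=> j; rewrite coef_sum big_seq; apply: (ideal_sum iQ) => u /sq[qu [_ Ou]].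
    by exists [:: (u.1, u.2`_j)]; rewrite big_seq1 coefZ; split=> // v; rewrite inE => /eqP -> /=; split; [|exact: Ou].
  split; last first.
    by move=> i; rewrite coef_sum big_seq; apply: ring_of_integers_sum => u /Os[].
  apply/leq_sizeP => j mj; rewrite coef_sum big_seq big1 // => u /Os[su _].
  by rewrite nth_default // (leq_trans su).
have qL0 : qLam 0 by exists [::]; rewrite big_nil.
have qLD x y : qLam x -> qLam y -> qLam (x + y).
  move=> [s [sq ->]] [s' [sq' ->]]; exists (s ++ s'); rewrite big_cat; split=> // u.
  by rewrite mem_cat => /orP[/sq|/sq'].
have -> : l = \sum_(i < m) l`_i *: 'X^i.
  rewrite -poly_def; apply/polyP=> i; rewrite coef_poly; case: ltnP => // mi.
  by rewrite nth_default // (leq_trans sl).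
apply: big_ind => // i _; have [s [sq ->]] := Ql i.
exists [seq (u.1, u.2 *: 'X^i) | u <- s]; rewrite big_map scaler_suml; split; last first.
  by apply: eq_bigr => u _; rewrite scalerA.
move=> _ /mapP[u /sq[qu Ou] ->]; split=> //=; split.
  by rewrite (leq_trans (size_scale_leq _ _)) // size_polyXn.
move=> j; rewrite coefZ coefXn; apply: ring_of_integersM => //.
exact: ring_of_integers_nat.
Qed.

Lemma reduction_ker l : Lam l -> (map_poly pi l = 0 <-> qLam l).
Proof.
move=> Ll; have [sl Ol] := Ll; split=> [l0|/qLamP[_ Ql]].
  by apply/qLamP; split=> // j; apply/pi_ker => //; rewrite -coef_reduction l0 coef0.
by apply/polyP=> j; rewrite coef_reduction coef0; apply/pi_ker.
Qed.

Lemma Lam1 : Lam 1.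
Proof.
split=> [|i]; first by rewrite size_poly1 degree_gt0.
by rewrite coef1; apply: ring_of_integers_nat.
Qed.

Lemma mulL1 l : Lam l -> mulL l 1 = l.
Proof.
move=> [sl _]; have s1 : (size (1%R : {poly L}) <= m)%N by rewrite size_poly1 degree_gt0.
apply/polyP=> k; rewrite coef_petit_mul ?rmorph0 //; case: ltnP => km; last first.
  by rewrite nth_default // (leq_trans sl).
rewrite (bigD1 (Ordinal km)) //= leqnn subnn coef1 big1 => [|i].
  by rewrite addr0 rmorph_nat mulr1.
rewrite -val_eqE /= => ik; have im := ltn_ord i.
case: (leqP i k) => lik; rewrite coef1.
  by rewrite (_ : (k - i == 0)%N = false) ?rmorph0 ?mulr0 //; apply/eqP; lia.
by rewrite (_ : (m + k - i == 0)%N = false) ?rmorph0 ?mul0r ?mulr0 //; apply/eqP; lia.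
Qed.

(** The image of [J] under reduction is a two-sided ideal of a simple algebra. If it is zero, [J]
    lies in the kernel q Lambda; if it is everything, 1 is in [J], which contradicts properness. *)
Lemma ideal_over_qLam (J : {poly L} -> Prop) :
  is_simple_alg (petit_carrier (fun _ : Kb => True) m) mulb ->
  two_sided_ideal Lam mulL J -> (exists l, Lam l /\ ~ J l) ->
  (forall l, qLam l -> J l) -> forall l, J l <-> qLam l.
Proof.
move=> [_ simple] [JL [J0 [JB JM]]] [l0 [Ll0 nJl0]] qJ.
pose Jb b := exists l, J l /\ map_poly pi l = b.
have LamN x : Lam x -> Lam (- x).
  by move=> [sx Ox]; split=> [|i]; rewrite ?size_polyN // coefN; apply: ring_of_integersN.
have redB x y : Lam x -> Lam y -> map_poly pi (x - y) = map_poly pi x - map_poly pi y.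
  move=> Lx Ly; rewrite reductionD //; last exact: LamN.
  by congr (_ + _); apply/polyP=> i; rewrite coefN !coef_reduction coefN residueN //; case: Ly.
have [||nz] := simple Jb; last 1 first.
- have [l [Jl l1]] : Jb 1 by apply/nz; split=> //; rewrite size_poly1 degree_gt0.
  case: nJl0; rewrite -(mulL1 Ll0).
  (* [l] lifts 1 inside [J], so it differs from 1 by an element of the kernel, and [J] contains the
     kernel. *)
  have Jl1 : J (l - 1).
    apply: qJ; apply/reduction_ker.
      split=> [|i]; last first.
        by rewrite coefB; apply: ring_of_integersB; [case: (JL _ Jl) | case: Lam1].
      by rewrite (leq_trans (size_polyD _ _)) // size_polyN geq_max; case: (JL _ Jl) => ->; case: Lam1.
    rewrite redB ?l1 //; [|exact: JL|exact: Lam1].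
    by apply/polyP=> i; rewrite coefB coef_reduction !coef1 coef0 residue_nat subrr.
  have J1 : J 1 by rewrite -[1](subKr l); apply: JB.
  by have [] := JM l0 1 Ll0 J1.
- split; first by move=> b [l [Jl <-]]; split=> //; apply: size_reduction; case: (JL _ Jl).
  split; first by exists 0; split=> //; apply/polyP=> i; rewrite coef_reduction !coef0 residue0.
  split; first by move=> _ _ [x [Jx <-]] [y [Jy <-]]; exists (x - y); rewrite redB; [split=> //; apply: JB|apply: JL|apply: JL].
  move=> a _ [sa _] [x [Jx <-]]; have [l [Ll <-]] := reduction_surj sa.
  have [J1 J2] := JM l x Ll Jx.
  by split; [exists (mulL l x) | exists (mulL x l)]; rewrite reductionM //; apply: JL.
move=> z l; split=> [Jl|/qJ //].
by apply/reduction_ker; [exact: JL | apply/z; exists l].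
Qed.

End Reduction.
End ResidueField.

Theorem theorem4
  (L : splittingFieldType rat) (F K : {subfield L}) (sigma : gal_of K) (m : nat)
  (c : L) (q : L -> Prop) :
  (* K/F cyclic Galois of degree m with Gal(K/F) = <sigma> *)
  (F <= K)%VS -> galois F K -> 'Gal(K / F)%g = <[sigma]>%g ->
  m = (\dim_F K)%N ->
  (* c in O_K \ O_F *)
  ring_of_integers K c -> ~ ring_of_integers F c ->
  (* A = (K/F, sigma, c) is a division algebra *)
  is_division_alg (petit_carrier (fun x => x \in K) m) (petit_mul sigma m c) ->
  (* q a nonzero prime ideal of O_F, inert in O_K *)
  is_prime_ideal (ring_of_integers F) q -> (exists x, q x /\ x <> 0) ->
  is_prime_ideal (ring_of_integers K) (ext_ideal q (ring_of_integers K)) ->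
  let OK := ring_of_integers K in
  let OF := ring_of_integers F in
  let Q := ext_ideal q OK in
  let Lam := petit_carrier OK m in
  let mulL := petit_mul sigma m c in
  let qLam := ideal_times q Lam in
  (* any presentation of the residue field Kbar = O_K/Q and of sigma-bar *)
  forall (Kb : fieldType) (pi : L -> Kb) (sigmab : Kb -> Kb),
    (forall x y, OK x -> OK y -> pi (x + y) = pi x + pi y) ->
    (forall x y, OK x -> OK y -> pi (x * y) = pi x * pi y) ->
    pi 1 = 1 ->
    (forall z, exists x, OK x /\ pi x = z) ->
    (forall x, OK x -> (pi x = 0 <-> Q x)) ->
    (forall u, OK u -> sigmab (pi u) = pi (sigma u)) ->
  let Fb := fun z : Kb => exists x, OF x /\ pi x = z in
  let cb := pi c in
  let Ab := petit_carrier (fun _ : Kb => True) m in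
  let mulb := petit_mul sigmab m cb in
  (* Kbar is a finite field, Kbar/Fbar cyclic of degree m with group <sigmab> *)
  (exists s : seq Kb, forall z, z \in s) /\
  (forall x y, sigmab (x + y) = sigmab x + sigmab y /\
               sigmab (x * y) = sigmab x * sigmab y) /\
  bijective sigmab /\
  (forall z, sigmab z = z <-> Fb z) /\
  (forall z, iter m sigmab z = z) /\
  (forall k, (0 < k < m)%N -> exists z, iter k sigmab z <> z) /\
  (* Lambda / q Lambda = (Kbar/Fbar, sigmab, cb) via coefficientwise reduction *)
  (forall l, Lam l -> Ab (map_poly pi l)) /\
  (forall b, Ab b -> exists l, Lam l /\ map_poly pi l = b) /\
  (forall l l', Lam l -> Lam l' -> map_poly pi (l + l') = map_poly pi l + map_poly pi l') /\
  (forall l l', Lam l -> Lam l' -> map_poly pi (mulL l l') = mulb (map_poly pi l) (map_poly pi l')) /\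
  (forall a l, OF a -> Lam l -> map_poly pi (a *: l) = pi a *: map_poly pi l) /\
  (forall l, Lam l -> (map_poly pi l = 0 <-> qLam l)) /\
  (* the division / ideal statement *)
  ((prime m /\ ~ Fb cb) \/
   (forall a : nat -> Kb, (forall i, Fb (a i)) ->
      \sum_(i < m) a i * cb ^+ i = 0 -> forall i, (i < m)%N -> a i = 0) ->
     is_division_alg Ab mulb /\ is_simple_alg Ab mulb /\
     is_central_over Fb Ab mulb /\
     (forall l, qLam l <-> (Lam l /\ forall j, Q l`_j)) /\
     (forall J, two_sided_ideal Lam mulL J -> (exists l, Lam l /\ ~ J l) ->
        (forall l, qLam l -> J l) -> forall l, J l <-> qLam l)).
Proof.
move=> FK galFK gen mE Oc nOc _ q_prime q_nz Q_prime OK OF Q Lam mulL qLam Kb pi sigmab.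
move=> piD piM pi1 pi_surj pi_ker sigmab_pi Fb cb Ab mulb.
have OKs := @sigma_OK L K sigma.
have [f fE] : exists f : {rmorphism Kb -> Kb}, sigmab = f.
  apply: rmorph_of_fun => [x y|x y|].
  - have [u [Ou <-]] := pi_surj x; have [v [Ov <-]] := pi_surj y.
    rewrite -piD // !sigmab_pi //; last exact: ring_of_integersD.
    by rewrite rmorphD piD //; apply: OKs.
  - have [u [Ou <-]] := pi_surj x; have [v [Ov <-]] := pi_surj y.
    rewrite -piM // !sigmab_pi //; last exact: ring_of_integersM.
    by rewrite rmorphM piM //; apply: OKs.
  by rewrite -{1}pi1 sigmab_pi ?rmorph1 //; apply: ring_of_integers1.
have m_gt0 : (0 < m)%N by apply: degree_gt0 mE.
(* Degree 1 would mean K = F, against c not being in O_F. *)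
have m_gt1 : (1 < m)%N.
  rewrite ltn_neqAle m_gt0 andbT; apply/eqP => m1; apply: nOc; case: Oc => cK ic; split=> //.
  have dFK : \dim F = \dim K.
    by rewrite (dim_sup_field FK) -mE -m1 mul1n.
  suff -> : F = K :> {vspace L} by [].
  by apply/eqP; rewrite eqEdim FK dFK leqnn.
subst sigmab.
have [s sP] := residue_field_finite q_prime q_nz piD piM pi1 pi_surj pi_ker.
have fixP := sigmab_fixed FK galFK gen mE q_prime q_nz piD piM pi1 pi_surj pi_ker sigmab_pi.
have fm := sigmab_period galFK gen mE pi_surj sigmab_pi.
have ker := reduction_ker FK q_prime Q_prime piD pi_ker.
split; first by exists s.
split; first by move=> x y; rewrite rmorphD rmorphM.
split.
  by exists (iter m.-1 f) => z; rewrite -?iterS -?iterSr prednK.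
split; first exact: fixP.
split; first exact: fm.
split.
  exact: (sigmab_faithful FK galFK gen mE q_prime q_nz piD piM pi1 pi_surj pi_ker sigmab_pi).
split; first by move=> l [sl _]; split=> //; apply: size_reduction.
split; first by move=> b [sb _]; apply: (reduction_surj piD pi_surj sb).
split; first by move=> l l'; apply: (reductionD piD).
split; first by move=> l l'; apply: (reductionM piD piM sigmab_pi Oc).
split; first by move=> a l Oa; apply: (reductionZ piD piM); apply: (OF_OK FK).
split; first exact: ker.
(* Both alternatives serve only to make the m conjugates of c-bar distinct. *)
move=> hyp; have conj_inj : forall i j, (i < m)%N -> (j < m)%N ->
    iter i f cb = iter j f cb -> i = j.
  apply: conj_inj_of_period; case: hyp => [[m_pr ncb]|free].
    by apply: prime_period => // /fixP.
  exact: free_period fixP free.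
have simple := petit_simple sP fm m_gt1 conj_inj.
split; first exact: (petit_division sP fm m_gt1 conj_inj).
split; first exact: simple.
split; first exact: (petit_central m_gt1 conj_inj fixP).
split; first exact: (qLamP m FK q_prime Q_prime).
move=> J; exact: (ideal_over_qLam FK galFK mE q_prime Q_prime piD piM pi1 pi_surj pi_ker sigmab_pi Oc simple).
Qed.
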